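(* Every natural number $n\in\mathbb{N}=\{0,1,2,\ldots\}$ can be written in each of the following five forms with $x,y,z\in\mathbb{Z}$: $$x^2+3y^2+t_z,\quad x^2+3t_y+t_z,\quad x^2+6t_y+t_z,\quad 3x^2+2t_y+t_z,\quad 4x^2+2t_y+t_z.$$ That is, for each of these five forms separately, there exist integers $x,y,z$ (depending on $n$ and the form) such that $n$ equals that expression.
   Context: For $x\in\mathbb{Z}$, $t_x$ denotes the triangular number $t_x=x(x+1)/2$. *)

(* Defs.v *)
From Stdlib Require Import ZArith.
Open Scope Z_scope.

(* Triangular number t_x = x(x+1)/2 for x in Z (the division is exact). *)
Definition tri (x : Z) : Z := x * (x + 1) / 2.

(* Main.v *)
(* Each form represents n as soon as an explicit k = 1, 2, 3, 5 or 6 mod 8 is a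
   sum of three squares: complete the squares, and read the vector of Z^3 with
   norm k in an orthogonal basis adapted to the form.

   For squarefree n, following Legendre and Dirichlet, n is a sum of three
   squares once there are A > 0 prime to n, s and B with n | A + s^2 and
   A | n + B^2: these give an integral positive ternary form of determinant 1
   representing n, and such a form is reducible to a sum of three squares.  By
   quadratic reciprocity A = p or A = 2p works for any prime p with suitable
   quadratic symbols modulo 8 and modulo the primes dividing n.

   Such a p is found without L-functions of complex characters.  For a
   nontrivial real character chi, Monsky's argument bounds the partial sums of
   chi(n)/n away from 0, so that Mertens' method bounds the sums of
   chi(p) log(p)/p, while the sums of log(p)/p diverge.  Hence the product of
   the factors 1 + X_i(c) X_i(p), once expanded into characters, has divergent
   weighted prime sum, so it is nonzero at some prime p. *)
Require Import Defs.
From Stdlib Require Import ZArith Lia Rpower.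
Open Scope Z_scope.

(** * Sums of three squares and unimodular ternary forms *)

(** Real characters are enough because [p] matters modulo a prime dividing [n] only up to squares.
    Moreover [p] is always taken 1 mod 4: then -1 is a square modulo [p] and reciprocity carries no
    sign, so once the symbols of [p] make [-A] a square modulo the odd part of [n], the symbol of
    [n] modulo [p] is forced by [n] and [p] modulo 8. The three shapes of [A] and [p] ([n] 1 mod 4,
    3 mod 8, even) are those for which the forced value is 1; for 7 mod 8 both [A = p] and [A = 2p]
    give -1. The analytic part takes no limits: finite sums over an ordered field, bounds with
    explicit natural constants, and a logarithm known only through additivity and the size of its
    increments. *)

Definition is_gram (a b c r s t : Z) : Prop :=
  exists x1 x2 x3 y1 y2 y3 z1 z2 z3,
    a = x1 * x1 + x2 * x2 + x3 * x3 /\ b = y1 * y1 + y2 * y2 + y3 * y3 /\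
    c = z1 * z1 + z2 * z2 + z3 * z3 /\ r = y1 * z1 + y2 * z2 + y3 * z3 /\
    s = x1 * z1 + x2 * z2 + x3 * z3 /\ t = x1 * y1 + x2 * y2 + x3 * y3.

Lemma is_gram_swap12 a b c r s t : is_gram b a c s r t -> is_gram a b c r s t.
Proof.
intros (x1 & x2 & x3 & y1 & y2 & y3 & z1 & z2 & z3 & H1 & H2 & H3 & H4 & H5 & H6).
exists y1, y2, y3, x1, x2, x3, z1, z2, z3; repeat split; lia.
Qed.

Lemma is_gram_swap23 a b c r s t : is_gram a c b r t s -> is_gram a b c r s t.
Proof.
intros (x1 & x2 & x3 & y1 & y2 & y3 & z1 & z2 & z3 & H1 & H2 & H3 & H4 & H5 & H6).
exists x1, x2, x3, z1, z2, z3, y1, y2, y3; repeat split; lia.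
Qed.

(** Equivalence of forms is carried by the vectors: subtracting [k] times the first vector from the
    second undoes the base change. *)
Lemma is_gram_shift k a b c r s t :
  is_gram a (b + 2 * k * t + k * k * a) c (r + k * s) s (t + k * a) ->
  is_gram a b c r s t.
Proof.
intros (x1 & x2 & x3 & y1 & y2 & y3 & z1 & z2 & z3 & H1 & H2 & H3 & H4 & H5 & H6).
exists x1, x2, x3, (y1 - k * x1), (y2 - k * x2), (y3 - k * x3), z1, z2, z3.
assert (Ht : t = x1 * y1 + x2 * y2 + x3 * y3 - k * a) by lia.
assert (Hr : r = y1 * z1 + y2 * z2 + y3 * z3 - k * s) by lia.
assert (Hb : b = y1 * y1 + y2 * y2 + y3 * y3 - 2 * k * t - k * k * a) by lia.
repeat split; trivial.
- rewrite Hb, Ht, H1; ring.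
- rewrite Hr, H5; ring.
- rewrite Ht, H1; ring.
Qed.

Lemma centered_residue t a : 0 < a -> exists k, - a <= 2 * (t + k * a) <= a.
Proof.
intros Ha; exists (- ((2 * t + a) / (2 * a))).
pose proof (Z.div_mod (2 * t + a) (2 * a) ltac:(lia)).
pose proof (Z.mod_pos_bound (2 * t + a) (2 * a) ltac:(lia)).
nia.
Qed.

(** Since [m] is at most [D / 2] in absolute value, [E D = a + m^2 < 3 D^2 / 4 + D^2 / 4]. Both
    reductions use this, the leading coefficient and the determinant exchanging roles. *)
Lemma reduced_binary_lt a D E m :
  0 < a -> 0 < D -> 4 * a < 3 * (D * D) -> - D <= 2 * m <= D ->
  E * D = a + m * m -> 0 < E < D.
Proof.
intros Ha HD H4 Hm HE.
assert (Hmm : 4 * (m * m) <= D * D) by nia.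
split; apply (Z.mul_pos_cancel_r _ D) || apply (Z.mul_lt_mono_pos_r D); nia.
Qed.

(* Gauss's reduction: alternately reduce the binary form [a, t, b] and the
   binary form adjoint to the last two variables; each step decreases one of
   [a] and [a * b - t * t], and both are 1 when neither step applies. *)
Lemma unimodular_ternary_is_gram a b c r s t :
  0 < a -> 0 < a * b - t * t ->
  a * b * c + 2 * r * s * t - a * r * r - b * s * s - c * t * t = 1 ->
  is_gram a b c r s t.
Proof.
intros Ha HD Hdet.
remember (Z.to_nat (a + (a * b - t * t))) as N eqn:HN.
revert a b c r s t Ha HD Hdet HN.
induction N as [N IH] using (well_founded_induction Nat.lt_wf_0).
intros a b c r s t Ha HD Hdet HN.
destruct (Z_lt_ge_dec (4 * (a * b - t * t)) (3 * (a * a))) as [H1|H1].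
- destruct (centered_residue t a Ha) as [k Hk].
  apply (is_gram_shift k), is_gram_swap12.
  assert (HD' : a * (b + 2 * k * t + k * k * a) - (t + k * a) * (t + k * a)
                = a * b - t * t) by ring.
  remember (b + 2 * k * t + k * k * a) as b' eqn:Hb'.
  remember (t + k * a) as t' eqn:Ht'.
  remember (r + k * s) as r' eqn:Hr'.
  assert (Hba : 0 < b' < a).
  { apply (reduced_binary_lt (a * b - t * t) a b' t'); lia. }
  assert (Hdet' : b' * a * c + 2 * s * r' * t' - b' * s * s - a * r' * r' - c * t' * t' = 1).
  { rewrite <- Hdet, Hb', Ht', Hr'; ring. }
  apply (IH (Z.to_nat (b' + (b' * a - t' * t')))); trivial; lia.
- destruct (Z_lt_ge_dec (4 * a) (3 * ((a * b - t * t) * (a * b - t * t)))) as [H2|H2].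
  + destruct (centered_residue (a * r - s * t) _ HD) as [k Hk].
    remember (c + 2 * k * r + k * k * b) as c' eqn:Hc'.
    remember (s + k * t) as s' eqn:Hs'.
    remember (r + k * b) as r' eqn:Hr'.
    assert (Hdet' : a * b * c' + 2 * r' * s' * t - a * r' * r' - b * s' * s' - c' * t * t = 1).
    { rewrite <- Hdet, Hc', Hs', Hr'; ring. }
    assert (Hm : a * r - s * t + k * (a * b - t * t) = a * r' - s' * t).
    { rewrite Hs', Hr'; ring. }
    rewrite Hm in Hk.
    (* A 2x2 minor of the adjoint matrix is the determinant, here 1, times an entry of the matrix,
       here [a]. *)
    assert (HE : (a * c' - s' * s') * (a * b - t * t)
                 = a + (a * r' - s' * t) * (a * r' - s' * t)).
    { transitivity (a * (a * b * c' + 2 * r' * s' * t - a * r' * r' - b * s' * s' - c' * t * t)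
        + (a * r' - s' * t) * (a * r' - s' * t)); [ring | rewrite Hdet'; ring]. }
    assert (HG : is_gram a c' b r' t s').
    { pose proof (reduced_binary_lt _ _ _ _ Ha HD H2 Hk HE).
      apply (IH (Z.to_nat (a + (a * c' - s' * s')))); trivial; lia. }
    apply is_gram_swap12, is_gram_swap23, (is_gram_shift k).
    rewrite <- Hc', <- Hr', <- Hs'.
    apply is_gram_swap12, is_gram_swap23, is_gram_swap12; trivial.
  + remember (a * b - t * t) as D eqn:EqD.
    (* The two failed tests give [27 a^4 <= 48 D^2 <= 64 a], so [a = 1], and likewise [D = 1]. *)
    assert (HaD : a = 1 /\ D = 1) by (clear - Ha HD H1 H2; nia).
    destruct HaD as [-> ->].
    assert (Hb : b = 1 + t * t) by lia.
    (* The rows of the triangular (Cholesky) factor; the determinant fixes [c]. *)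
    exists 1, 0, 0, t, 1, 0, s, (r - s * t), 1.
    repeat split; try lia.
Qed.

Definition sum3sq (n : Z) : Prop := exists x y z, n = x * x + y * y + z * z.

(* With [A * C = n + B^2], the binary form [A, B, C] has determinant [n], and
   the ternary form [(A x^2 + 2 B x y + C y^2 + (n z + m x + v y)^2) / n] is
   integral of determinant 1 and takes the value [n] at [(0, 0, 1)]. *)
Lemma sum3sq_of_residues n A m B :
  0 < n -> 0 < A -> (exists A' k, A * A' = 1 + n * k) ->
  (n | A + m * m) -> (A | n + B * B) -> sum3sq n.
Proof.
intros Hn HA (A' & k & HA') [a Ha] [C HC].
(* As [A'] inverts [A] modulo [n], this [v] makes [A x^2 + 2 B x y + C y^2] congruent to
   [-(m x + v y)^2] modulo [n]; [a], [t], [b] are the resulting quotients. *)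
set (v := m * B * A').
set (t := a * B * A' - k * B).
set (b := a * (B * B) * (A' * A') - 2 * k * C - n * (k * k) * C + A * (A' * A')).
assert (Hm : m * m = a * n - A) by lia.
assert (HB : B * B = C * A - n) by lia.
assert (Ht : n * t = B + m * v).
{ transitivity (B + (m * m) * (B * A')); [|unfold v; ring].
  rewrite Hm; transitivity (B * (1 - A * A') + n * a * B * A'); [|ring].
  rewrite HA'; unfold t; ring. }
assert (Hb : n * b = C + v * v).
{ transitivity (C + (m * m) * (B * B) * (A' * A')); [|unfold v; ring].
  rewrite Hm.
  transitivity (C + n * a * (B * B) * (A' * A') - A * (B * B) * (A' * A')); [|ring].
  transitivity (C + n * a * (B * B) * (A' * A') - C * ((A * A') * (A * A')) + n * (A * (A' * A'))).
  - rewrite HA'; unfold b; ring.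
  - rewrite HB; ring. }
assert (Ha' : n * a = A + m * m) by lia.
assert (HAC : A * C - B * B = n) by lia.
clearbody t b v; clear Hm HB HA' k A' Ha HC.
assert (HD : n * (n * (a * b - t * t)) = n + (A * v * v - 2 * B * m * v + C * m * m)).
{ transitivity ((n * a) * (n * b) - (n * t) * (n * t)); [ring|].
  rewrite Ha', Hb, Ht, <- HAC; ring. }
(* For positivity of the minor: the form [[A, B, C]] is nonnegative at [(v, -m)], by completing the
   square. *)
assert (HP : A * (A * v * v - 2 * B * m * v + C * m * m)
             = (A * v - B * m) * (A * v - B * m) + n * (m * m)).
{ rewrite <- HAC; ring. }
assert (Hdet : n * (a * b * n + 2 * v * m * t - a * v * v - b * m * m - n * t * t) = n).
{ transitivity ((n * a) * (n * b) + 2 * v * m * (n * t) - (n * a) * v * v - (n * b) * m * m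
                - (n * t) * (n * t)); [ring|].
  rewrite Ha', Hb, Ht, <- HAC; ring. }
destruct (unimodular_ternary_is_gram a b n v m t) as
  (x1 & x2 & x3 & y1 & y2 & y3 & z1 & z2 & z3 & _ & _ & H3 & _).
- apply (Z.mul_pos_cancel_l n a Hn); rewrite Ha'.
  pose proof (Z.square_nonneg m); lia.
- apply (proj1 (Z.mul_pos_cancel_l n _ Hn)), (proj1 (Z.mul_pos_cancel_l n _ Hn)); rewrite HD.
  assert (0 <= A * v * v - 2 * B * m * v + C * m * m); [|lia].
  apply (Z.mul_nonneg_cancel_l A _ HA); rewrite HP.
  pose proof (Z.square_nonneg (A * v - B * m)).
  pose proof (Z.mul_nonneg_nonneg n (m * m) ltac:(lia) (Z.square_nonneg m)); lia.
- apply (Z.mul_reg_l _ _ n); lia.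
- exists z1, z2, z3; trivial.
Qed.

(** * The five forms from sums of three squares *)

Lemma pronic_even k : exists j, k * k + k = 2 * j.
Proof. destruct (Z.Even_or_Odd k) as [[i ->]|[i ->]]; [exists (2*i*i+i)|exists (2*i*i+3*i+1)]; ring. Qed.

Lemma tri_odd k : 8 * tri k + 1 = (2 * k + 1) * (2 * k + 1).
Proof.
unfold tri; destruct (pronic_even k) as [j Hj].
replace (k * (k + 1)) with (j * 2) by lia.
rewrite Z.div_mul by lia; lia.
Qed.

Lemma sign_mod8 a j : a = 2 * j + 1 ->
  exists k, a * a = (8 * k + 1) * (8 * k + 1) \/ a * a = (8 * k + 3) * (8 * k + 3).
Proof.
intros ->; set (q := (2 * j + 1) / 8).
pose proof (Z.div_mod (2 * j + 1) 8 ltac:(lia)).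
pose proof (Z.mod_pos_bound (2 * j + 1) 8 ltac:(lia)).
assert (H1 : j = 4 * q \/ j = 4 * q + 1 \/ j = 4 * q + 2 \/ j = 4 * q + 3) by (unfold q; lia).
clearbody q; destruct H1 as [ -> | [ -> | [ -> | -> ]]].
- exists q; left; ring.
- exists q; right; ring.
- exists (- q - 1); right; ring.
- exists (- q - 1); left; ring.
Qed.

Lemma sign_mod3 a : exists k, a = 3 * k \/ a * a = (3 * k + 1) * (3 * k + 1).
Proof.
set (q := a / 3).
pose proof (Z.div_mod a 3 ltac:(lia)).
pose proof (Z.mod_pos_bound a 3 ltac:(lia)).
assert (H1 : a = 3 * q \/ a = 3 * q + 1 \/ a = 3 * q + 2) by (unfold q; lia).
clearbody q; destruct H1 as [ -> | [ -> | -> ]].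
- exists q; left; ring.
- exists q; right; ring.
- exists (- q - 1); right; ring.
Qed.

(* After a choice of signs the three odd roots are 1 or 3 mod 8, so two of them
   agree mod 8, i.e. are [v + 4 x] and [v - 4 x]. *)
Lemma form5 n : sum3sq (8 * n + 3) -> exists x y z, n = 4 * (x * x) + 2 * tri y + tri z.
Proof.
assert (Hcore : forall x v w, (exists i, v = 2 * i + 1) -> (exists j, w = 2 * j + 1) ->
  8 * n + 3 = (v + 4 * x) * (v + 4 * x) + (v - 4 * x) * (v - 4 * x) + w * w ->
  exists x y z, n = 4 * (x * x) + 2 * tri y + tri z).
{ intros x v w [i ->] [j ->] H; exists x, i, j.
  pose proof (tri_odd i); pose proof (tri_odd j); lia. }
intros (a & b & c & H).
assert (Hodd : (exists i, a = 2 * i + 1) /\ (exists i, b = 2 * i + 1) /\ (exists i, c = 2 * i + 1)).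
{ destruct (Z.Even_or_Odd a) as [[i ->]|[i ->]], (Z.Even_or_Odd b) as [[j ->]|[j ->]],
    (Z.Even_or_Odd c) as [[k ->]|[k ->]];
  pose proof (pronic_even i) as [i' Hi]; pose proof (pronic_even j) as [j' Hj];
  pose proof (pronic_even k) as [k' Hk]; try lia.
  repeat split; eexists; reflexivity. }
destruct Hodd as ((i & Hi) & (j & Hj) & (k & Hk)).
destruct (sign_mod8 a i Hi) as [a' Ha], (sign_mod8 b j Hj) as [b' Hb], (sign_mod8 c k Hk) as [c' Hc].
rewrite H in Hcore; clear H Hi Hj Hk.
assert (Hodd : forall r s, exists i, 4 * r + 4 * s + 1 = 2 * i + 1).
{ intros r s; exists (2 * (r + s)); ring. }
assert (Hodd3 : forall r s, exists i, 4 * r + 4 * s + 3 = 2 * i + 1).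
{ intros r s; exists (2 * (r + s) + 1); ring. }
assert (Hodd' : forall r, exists i, 8 * r + 1 = 2 * i + 1).
{ intros r; exists (4 * r); ring. }
assert (Hodd3' : forall r, exists i, 8 * r + 3 = 2 * i + 1).
{ intros r; exists (4 * r + 1); ring. }
destruct Ha as [Ha|Ha], Hb as [Hb|Hb], Hc as [Hc|Hc]; rewrite Ha, Hb, Hc in Hcore.
- apply (Hcore (a' - b') (4 * a' + 4 * b' + 1) (8 * c' + 1)); trivial; ring.
- apply (Hcore (a' - b') (4 * a' + 4 * b' + 1) (8 * c' + 3)); trivial; ring.
- apply (Hcore (a' - c') (4 * a' + 4 * c' + 1) (8 * b' + 3)); trivial; ring.
- apply (Hcore (b' - c') (4 * b' + 4 * c' + 3) (8 * a' + 1)); trivial; ring.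
- apply (Hcore (b' - c') (4 * b' + 4 * c' + 1) (8 * a' + 3)); trivial; ring.
- apply (Hcore (a' - c') (4 * a' + 4 * c' + 3) (8 * b' + 1)); trivial; ring.
- apply (Hcore (a' - b') (4 * a' + 4 * b' + 3) (8 * c' + 1)); trivial; ring.
- apply (Hcore (a' - b') (4 * a' + 4 * b' + 3) (8 * c' + 3)); trivial; ring.
Qed.

(* Squares summing to a multiple of 3 are all zero or all nonzero mod 3, so
   signs can be chosen to make the three roots congruent mod 3. *)
Lemma sum3sq_congruent_mod3 N : sum3sq (3 * N) ->
  exists a i j, 3 * N = a * a + (a + 3 * i) * (a + 3 * i) + (a + 3 * j) * (a + 3 * j).
Proof.
intros (a & b & c & H); rewrite H.
destruct (sign_mod3 a) as [a' [Ha|Ha]], (sign_mod3 b) as [b' [Hb|Hb]],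
  (sign_mod3 c) as [c' [Hc|Hc]]; try subst a; try subst b; try subst c; try lia.
- exists (3 * a'), (b' - a'), (c' - a'); ring.
- rewrite Ha, Hb, Hc; exists (3 * a' + 1), (b' - a'), (c' - a'); ring.
Qed.

(* (1,1,1), (1,1,-2), (1,-1,0) are orthogonal of norms 3, 6, 2. *)
Lemma sum_1_2_6_of_sum3sq N : sum3sq (3 * N) ->
  exists w v u, N = w * w + 2 * (v * v) + 6 * (u * u).
Proof.
intros HN; destruct (sum3sq_congruent_mod3 N HN) as (a & i & j & H).
(* One of [i], [j], [i - j] is even; the coordinates are permuted so that this difference is the one
   read along (1,-1,0), which makes [u] and [v] integral. *)
destruct (Z.Even_or_Odd i) as [[i' Hi]|[i' Hi]].
- exists (a + i + j), (i' - j), i'; subst i; lia.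
- destruct (Z.Even_or_Odd j) as [[j' Hj]|[j' Hj]].
  + exists (a + i + j), (j' - i), j'; subst j; lia.
  + exists (a + i + j), (i' + j' + 1), (i' - j'); subst i j; lia.
Qed.

(** For odd [w], the value of [w^2 + 2 v^2 + 6 u^2] modulo 8 is 3 for [v] odd and [u] even, 7 for
    [v] even and [u] odd, and 1 when [v] and [u] have equal parity. So the residue fixes the
    parities here and in [form3], and leaves two patterns in [form1]. *)
Lemma form4 n : sum3sq (3 * (8 * n + 3)) -> exists x y z, n = 3 * (x * x) + 2 * tri y + tri z.
Proof.
intros HN; destruct (sum_1_2_6_of_sum3sq _ HN) as (w & v & u & H).
destruct (Z.Even_or_Odd w) as [[k Hk]|[k Hk]], (Z.Even_or_Odd v) as [[j Hj]|[j Hj]],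
  (Z.Even_or_Odd u) as [[i Hi]|[i Hi]]; subst w v u;
  pose proof (pronic_even k) as [k' Hk']; pose proof (pronic_even j) as [j' Hj'];
  pose proof (pronic_even i) as [i' Hi']; try lia.
exists i, j, k; pose proof (tri_odd j); pose proof (tri_odd k); lia.
Qed.

Lemma form3 n : sum3sq (3 * (8 * n + 7)) -> exists x y z, n = x * x + 6 * tri y + tri z.
Proof.
intros HN; destruct (sum_1_2_6_of_sum3sq _ HN) as (w & v & u & H).
destruct (Z.Even_or_Odd w) as [[k Hk]|[k Hk]], (Z.Even_or_Odd v) as [[j Hj]|[j Hj]],
  (Z.Even_or_Odd u) as [[i Hi]|[i Hi]]; subst w v u;
  pose proof (pronic_even k) as [k' Hk']; pose proof (pronic_even j) as [j' Hj'];
  pose proof (pronic_even i) as [i' Hi']; try lia.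
exists j, i, k; pose proof (tri_odd i); pose proof (tri_odd k); lia.
Qed.

Lemma form1 n : sum3sq (3 * (8 * n + 1)) -> exists x y z, n = x * x + 3 * (y * y) + tri z.
Proof.
intros HN; destruct (sum_1_2_6_of_sum3sq _ HN) as (w & v & u & H).
assert (Hcore : forall k x y, 8 * n + 1 = (2 * k + 1) * (2 * k + 1) + 8 * (x * x) + 24 * (y * y) ->
  exists x y z, n = x * x + 3 * (y * y) + tri z).
{ intros k x y E; exists x, y, k; pose proof (tri_odd k); lia. }
destruct (Z.Even_or_Odd w) as [[k Hk]|[k Hk]], (Z.Even_or_Odd v) as [[j Hj]|[j Hj]],
  (Z.Even_or_Odd u) as [[i Hi]|[i Hi]]; subst w v u;
  pose proof (pronic_even k) as [k' Hk']; pose proof (pronic_even j) as [j' Hj'];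
  pose proof (pronic_even i) as [i' Hi']; try lia.
- apply (Hcore k j i); lia.
(* All three are odd. Multiplying [v + u sqrt(-3)] by a sixth root of unity keeps [v^2 + 3 u^2]; the
   root is chosen by [v - u] modulo 4 so that both new coordinates are even. *)
- destruct (Z.Even_or_Odd (j - i)) as [[d Hd]|[d Hd]].
  + apply (Hcore k (d + 2 * i + 1) d); replace j with (i + 2 * d) in H by lia; lia.
  + apply (Hcore k (d - i) (d + i + 1)); replace j with (i + 2 * d + 1) in H by lia; lia.
Qed.

(* The plane orthogonal to (1,1,1) in Z^3 carries twice the form P^2+PQ+Q^2. *)
Lemma form2 n : sum3sq (6 * (2 * n + 1)) -> exists x y z, n = x * x + 3 * tri y + tri z.
Proof.
replace (6 * (2 * n + 1)) with (3 * (2 * (2 * n + 1))) by ring.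
intros HN; destruct (sum3sq_congruent_mod3 _ HN) as (a & i & j & H).
assert (Hpar : exists x, a + i + j = 2 * x).
{ destruct (Z.Even_or_Odd a) as [[k Hk]|[k Hk]], (Z.Even_or_Odd i) as [[i' Hi]|[i' Hi]],
    (Z.Even_or_Odd j) as [[j' Hj]|[j' Hj]]; subst a i j; try lia; eexists; try reflexivity.
  - instantiate (1 := k + i' + j' + 1); ring.
  - instantiate (1 := k + i' + j' + 1); ring.
  - instantiate (1 := k + i' + j' + 1); ring. }
destruct Hpar as [x Hx].
assert (HPQ : exists P Q, 2 * n + 1 = 2 * (x * x) + P * P + P * Q + Q * Q).
{ exists (- j), i; replace a with (2 * x - i - j) in H by lia; lia. }
destruct HPQ as (P & Q & HPQ).
assert (Hcore : forall k l, 4 * (2 * n + 1) = 8 * (x * x) + (2 * k + 1) * (2 * k + 1)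
    + 3 * ((2 * l + 1) * (2 * l + 1)) -> exists x y z, n = x * x + 3 * tri y + tri z).
{ intros k l E; exists x, l, k; pose proof (tri_odd k); pose proof (tri_odd l); lia. }
(* [4 (P^2 + P Q + Q^2)] is both [(2 P + Q)^2 + 3 Q^2] and [(2 Q + P)^2 + 3 P^2]; the form is odd
   here, so [P] or [Q] is odd. *)
destruct (Z.Even_or_Odd Q) as [[q Hq]|[q Hq]].
- destruct (Z.Even_or_Odd P) as [[p Hp]|[p Hp]]; subst P Q; [lia|].
  apply (Hcore (2 * q + p) p); lia.
- subst Q; apply (Hcore (P + q) q); lia.
Qed.

From mathcomp Require Import all_boot all_order all_algebra.
From mathcomp Require Import finfield Rstruct lra ring zify.
Set Implicit Arguments.
Unset Strict Implicit.
Unset Printing Implicit Defensive.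
Import Order.TTheory GRing.Theory Num.Theory.
Local Open Scope nat_scope.
Local Open Scope ring_scope.

(** * Real characters and the lower bound for L(1, chi) *)

Section Sums.
Variable R : realFieldType.
Implicit Types (F chi g : nat -> R).

Lemma sum_multiples F d N : (0 < d)%N ->
  \sum_(1 <= j < N.+1 | (d %| j)%N) F j = \sum_(1 <= k < (N %/ d).+1) F (d * k)%N.
Proof.
move=> d_gt0; elim: N => [|N IH]; first by rewrite div0n !big_nil.
rewrite big_mkcond big_nat_recr //= -big_mkcond /= IH divnS //.
case: (boolP (d %| N.+1)%N) => [dv|_]; last by rewrite add0n addr0.
have E : (d * (N %/ d).+1 = N.+1)%N.
  by rewrite mulnC -(divnK dv) (divnS N) // dv add1n.
by rewrite add1n [RHS]big_nat_recr //= E.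
Qed.

Lemma sum_divisors F n N : (0 < n <= N)%N ->
  \sum_(d <- divisors n) F d = \sum_(1 <= d < N.+1 | (d %| n)%N) F d.
Proof.
case/andP=> n_gt0 le_nN; rewrite -[RHS]big_filter; apply: perm_big.
apply: uniq_perm; rewrite ?divisors_uniq ?filter_uniq ?iota_uniq // => d.
rewrite -dvdn_divisors // mem_filter mem_index_iota.
case: (boolP (d %| n)%N) => //= dv.
by rewrite (dvdn_gt0 n_gt0 dv) ltnS (leq_trans (dvdn_leq n_gt0 dv)).
Qed.

(** The offset [c] stands for the terms already peeled off, which lets the induction move the
    starting index [a]. *)
Lemma abel_le chi g (M c : R) a n :
  (forall k, (k <= n)%N -> c + \sum_(a <= i < a + k) chi i <= M) ->
  (forall i, 0 <= g i) -> (forall i, (a <= i)%N -> g i.+1 <= g i) ->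
  c * g a + \sum_(a <= i < a + n) chi i * g i <= M * g a.
Proof.
move=> HM g_ge0; elim: n a c HM => [|n IH] a c HM g_dec.
  rewrite addn0 big_geq // addr0 ler_wpM2r //.
  by have := HM 0%N isT; rewrite addn0 big_geq // addr0.
rewrite -addSnnS big_ltn; last by rewrite addSn ltnS leq_addr.
have H1 : c + chi a <= M by have := HM 1%N isT; rewrite addn1 big_nat1.
have H2 : (c + chi a) * g a.+1 + \sum_(a.+1 <= i < a.+1 + n) chi i * g i <= M * g a.+1.
  apply: IH => [k lekn|i lt_ai]; last by apply/g_dec/ltnW.
  by have := HM k.+1 lekn; rewrite -addSnnS big_ltn ?addrA // addSn ltnS leq_addr.
have H3 := g_dec a (leqnn a).
have H4 : 0 <= (M - (c + chi a)) * (g a - g a.+1) by rewrite mulr_ge0 ?subr_ge0.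
lra.
Qed.

Lemma abel_norm_le chi g (M : R) a n :
  (forall k, (k <= n)%N -> `|\sum_(a <= i < a + k) chi i| <= M) ->
  (forall i, 0 <= g i) -> (forall i, (a <= i)%N -> g i.+1 <= g i) ->
  `|\sum_(a <= i < a + n) chi i * g i| <= M * g a.
Proof.
move=> HM g_ge0 g_dec; rewrite ler_norml; apply/andP; split.
  rewrite lerNl -sumrN; have := @abel_le (fun i => - chi i) g M 0 a n.
  rewrite mul0r add0r; under eq_bigr do rewrite mulNr; apply=> // k /HM.
  by rewrite add0r sumrN ler_norml lerNl => /andP[].
have := @abel_le chi g M 0 a n; rewrite mul0r add0r; apply=> // k /HM.
by rewrite add0r ler_norml => /andP[].
Qed.

End Sums.

Section RealCharacters.
Variable R : realFieldType.
Implicit Types (chi psi : nat -> R) (m : nat).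

Record real_char m chi : Prop := RealChar {
  rcharM : forall a b, chi (a * b)%N = chi a * chi b;
  rcharD : forall a, chi (a + m)%N = chi a;
  rchar_unit : forall a, coprime a m -> chi a = 1 \/ chi a = -1;
  rchar_nunit : forall a, ~~ coprime a m -> chi a = 0 }.

Lemma real_char_mul m chi psi : real_char m chi -> real_char m psi ->
  real_char m (fun a => chi a * psi a).
Proof.
move=> [M1 D1 U1 N1] [M2 D2 U2 N2]; split=> [a b|a|a /[dup] /U1 H1 /U2 H2|a /N1 ->].
- by rewrite M1 M2 mulrACA.
- by rewrite D1 D2.
- by case: H1 H2 => -> [] ->; rewrite ?mulrNN ?mul1r ?mulr1; [left|right|right|left].
- by rewrite mul0r.
Qed.

Variables (m : nat) (chi : nat -> R).
Hypotheses (m_gt0 : (0 < m)%N) (chiP : real_char m chi).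

Lemma rchar_mod a : chi (a %% m)%N = chi a.
Proof.
rewrite [in RHS](divn_eq a m); elim: (a %/ m)%N => [|k IH]; first by rewrite mul0n.
by rewrite mulSn -addnA addnC (rcharD chiP).
Qed.

Lemma rchar_norm_le1 a : `|chi a| <= 1.
Proof.
case: (boolP (coprime a m)) => [/(rchar_unit chiP)[]->|/(rchar_nunit chiP)->].
- by rewrite normr1.
- by rewrite normrN1.
- by rewrite normr0.
Qed.

Hypothesis chi_nontriv : exists u, chi u = -1.

(** Multiplication by a unit of value -1 permutes the residues and negates the sum. *)
Lemma rchar_sum_period a : \sum_(a <= i < a + m) chi i = 0.
Proof.
have [u chi_u] := chi_nontriv.
have cop_um : coprime u m.
  apply: contraT => /(rchar_nunit chiP); rewrite chi_u => /eqP.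
  by rewrite oppr_eq0 oner_eq0.
elim: a => [|a IH]; last first.
  have lt_a : (a < a + m)%N by rewrite -{1}[a]addn0 ltn_add2l.
  rewrite -[RHS]IH addSn big_nat_recr //= (rcharD chiP).
  rewrite [RHS]big_ltn //; exact: addrC.
rewrite add0n big_mkord; set S := \sum_(i < m) _.
pose h (i : 'I_m) := Ordinal (ltn_pmod (u * i) m_gt0).
have h_inj : injective h.
  move=> i j /(congr1 val) /= /eqP; rewrite -[_ == _]/(_ == _ %[mod _]) => Eij.
  apply/val_inj => /=; wlog le_ij: i j Eij / (i <= j)%N.
    by move=> W; case/orP: (leq_total i j) => ?; [|symmetry]; apply: W => //; rewrite eq_sym.
  move: Eij; rewrite eq_sym eqn_mod_dvd ?leq_mul2l ?le_ij ?orbT //.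
  rewrite -mulnBr Gauss_dvdr 1?coprime_sym // => /dvdn_leq H.
  have := ltn_ord j; case: (posnP (j - i)) => [|/H]; lia.
have : S = - S.
  rewrite {1}/S (reindex_inj h_inj) /= -sumrN; apply: eq_bigr => i _.
  by rewrite rchar_mod (rcharM chiP) chi_u mulN1r.
lra.
Qed.

Lemma rchar_sum_le a k : `|\sum_(a <= i < a + k) chi i| <= m%:R.
Proof.
have [n] := ubnP k; elim: n a k => // n IH a k; rewrite ltnS => le_kn.
case: (leqP k m) => [le_km|lt_mk].
  apply: (@le_trans _ _ (k%:R)); last by rewrite ler_nat.
  apply: le_trans (ler_norm_sum _ _ _) _.
  apply: (@le_trans _ _ (\sum_(a <= i < a + k) 1)).
    by apply: ler_sum => i _; apply: rchar_norm_le1.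
  by rewrite sumr_const_nat addKn.
rewrite (@big_cat_nat _ _ _ (a + m)) ?leq_addr ?leq_add2l //=; last exact: ltnW.
rewrite rchar_sum_period add0r (_ : (a + k = a + m + (k - m))%N); last by lia.
apply: IH; lia.
Qed.

End RealCharacters.

(** Splits a divisor sum along one prime power, for characters as well as for the von Mangoldt
    function. *)
Lemma perm_divisors_pfactor p e n : prime p -> (0 < n)%N -> ~~ (p %| n)%N ->
  perm_eq (divisors (p ^ e * n)) [seq (p ^ i * d)%N | i <- iota 0 e.+1, d <- divisors n].
Proof.
move=> p_pr n_gt0 pn; have p_gt0 := prime_gt0 p_pr.
have pen_gt0 : (0 < p ^ e * n)%N by rewrite muln_gt0 expn_gt0 p_gt0.
apply: uniq_perm => [||d]; first exact: divisors_uniq.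
  apply: allpairs_uniq; rewrite ?iota_uniq ?divisors_uniq //.
  move=> [i d] [j d'] /allpairsPdep[i1 [d1 [_ Hd [Ei Ed]]]].
  move=> /allpairsPdep[j1 [d2 [_ Hd' [Ej Ed']]]] /= E; subst i1 d1 j1 d2.
  have nd x : x \in divisors n -> (0 < x)%N /\ logn p x = 0%N.
    rewrite -dvdn_divisors // => xn; split; first exact: dvdn_gt0 xn.
    by apply/eqP; rewrite -leqn0 leqNgt logn_gt0 mem_primes; apply: contra pn => /and3P[_ _ /dvdn_trans->].
  have [d_gt0 ld] := nd _ Hd; have [d'_gt0 ld'] := nd _ Hd'.
  have := congr1 (logn p) E; rewrite !lognM ?expn_gt0 ?p_gt0 // !pfactorK // ld ld' !addn0 => Eij.
  by move: E; rewrite Eij => /eqP; rewrite eqn_pmul2l ?expn_gt0 ?p_gt0 // => /eqP ->.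
rewrite -dvdn_divisors //; apply/idP/idP => [dv|/allpairsPdep[i [d' [Hi Hd' ->]]]]; last first.
  apply: dvdn_mul; last by rewrite dvdn_divisors.
  by apply: dvdn_exp2l; move: Hi; rewrite mem_iota.
have d_gt0 : (0 < d)%N := dvdn_gt0 pen_gt0 dv.
have [|d' pd' Ed] := @pfactor_coprime p d p_pr; first exact: d_gt0.
apply/allpairsPdep; exists (logn p d), d'; split; last by rewrite mulnC.
  have : (p ^ logn p d %| p ^ e * n)%N by apply: dvdn_trans dv; rewrite {2}Ed dvdn_mull.
  rewrite Gauss_dvdl; last by rewrite coprimeXl // prime_coprime.
  by rewrite dvdn_Pexp2l ?prime_gt1 // mem_iota add0n ltnS.
rewrite -dvdn_divisors //.
have : (d' %| p ^ e * n)%N by apply: dvdn_trans dv; rewrite [X in (_ %| X)%N]Ed dvdn_mulr.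
by rewrite Gauss_dvdr // coprimeXr // coprime_sym.
Qed.

Section DivisorSum.
Variable R : realFieldType.
Variables (m : nat) (chi : nat -> R).
Hypothesis chiP : real_char m chi.

Lemma rchar1 : chi 1%N = 1.
Proof.
have := rcharM chiP 1 1; rewrite mul1n.
by case: (rchar_unit chiP (coprime1n m)) => -> //; rewrite mulrNN mul1r.
Qed.

Lemma rcharX a k : chi (a ^ k)%N = chi a ^+ k.
Proof. by elim: k => [|k IH]; rewrite ?expn0 ?rchar1 // expnS exprS (rcharM chiP) IH. Qed.

(** The local factor is [e + 1], the parity indicator of [e], or 1, as [chi a] is 1, -1 or 0. *)
Lemma rchar_geom_ge0 a e :
  0 <= \sum_(0 <= i < e.+1) chi (a ^ i)%N /\ (~~ odd e -> 1 <= \sum_(0 <= i < e.+1) chi (a ^ i)%N).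
Proof.
have: chi a = 1 \/ chi a = -1 \/ chi a = 0.
  by case: (boolP (coprime a m)) => [/(rchar_unit chiP)|/(rchar_nunit chiP)]; tauto.
under eq_bigr do rewrite rcharX.
case=> [->|[->|->]].
- under eq_bigr do rewrite expr1n.
  by rewrite sumr_const_nat subn0 ler0n ler1n.
- suff -> : \sum_(0 <= i < e.+1) (-1 : R) ^+ i = (~~ odd e)%:R by case: odd; rewrite ?lexx ?ler01.
  elim: e => [|e IH]; first by rewrite big_nat1.
  by rewrite big_nat_recr //= IH -signr_odd /=; case: odd; rewrite /= ?expr1 ?expr0 ?add0r ?subrr.
- rewrite big_nat_recl // expr0 big1 ?addr0 ?ler01 ?lexx // => i _.
  by rewrite expr0n.
Qed.

(** The sum is the product of its local factors; even valuations everywhere mean that [n] is a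
    square. *)
Lemma rchar_divisor_sum n : (0 < n)%N ->
  0 <= \sum_(d <- divisors n) chi d /\
  ((forall p, ~~ odd (logn p n)) -> 1 <= \sum_(d <- divisors n) chi d).
Proof.
have [N] := ubnP n; elim: N n => // N IH n; rewrite ltnS => le_nN n_gt0.
case: (leqP n 1) => [le_n1|n_gt1].
  have -> : n = 1%N by lia.
  by rewrite (_ : divisors 1 = [:: 1%N]) // big_seq1 rchar1 ler01 lexx.
have p_pr := pdiv_prime n_gt1; set p := pdiv n in p_pr.
have [|n' pn' En] := @pfactor_coprime p n p_pr; first exact: n_gt0.
have n'_gt0 : (0 < n')%N by move: n_gt0; rewrite En muln_gt0 => /andP[].
have ndv : ~~ (p %| n')%N by rewrite -prime_coprime.
have lt_n'n : (n' < n)%N.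
  rewrite En ltn_Pmulr // -{1}(exp1n (logn p n)) ltn_exp2r ?prime_gt1 //.
  by rewrite logn_gt0 mem_primes p_pr n_gt0 pdiv_dvd.
have [IH0 IH1] := IH n' (leq_trans lt_n'n le_nN) n'_gt0.
have [G0 G1] := rchar_geom_ge0 p (logn p n).
have -> : \sum_(d <- divisors n) chi d =
   (\sum_(0 <= i < (logn p n).+1) chi (p ^ i)%N) * \sum_(d <- divisors n') chi d.
  rewrite {1}En mulnC (perm_big _ (perm_divisors_pfactor _ p_pr n'_gt0 ndv)).
  rewrite big_allpairs_dep mulr_suml /index_iota subn0; apply: eq_bigr => i _.
  by rewrite mulr_sumr; apply: eq_bigr => d _; rewrite (rcharM chiP).
split; first exact: mulr_ge0.
move=> sq; have {}G1 := G1 (sq p).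
have {}IH1 : 1 <= \sum_(d <- divisors n') chi d.
  apply: IH1 => q; case: (eqVneq q p) => [->|qp]; first by rewrite logn_coprime.
  have := sq q; rewrite {1}En lognM ?pfactor_gt0 //.
  by rewrite lognX (@logn_prime q p) // (negPf qp) muln0 addn0.
by rewrite -[1]mulr1 ler_pM.
Qed.

End DivisorSum.

(** * Geometric sums and the weights of Monsky's comparison *)

Section Geometric.
Variable R : realFieldType.
Implicit Types s t : R.

(** Equal to [(1 - t^n) / (1 - t)], and still meaningful at [t = 1]. *)
Definition geom t n := \sum_(0 <= i < n) t ^+ i.

Lemma geomS t n : geom t n.+1 = 1 + t * geom t n.
Proof.
rewrite /geom big_nat_recl // expr0 mulr_sumr; congr (_ + _).
by apply: eq_bigr => i _; rewrite exprS.
Qed.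

Lemma geomE t n : (1 - t) * geom t n = 1 - t ^+ n.
Proof.
elim: n => [|n IH]; first by rewrite /geom big_geq // mulr0 expr0 subrr.
by rewrite geomS mulrDr mulrCA IH exprS; ring.
Qed.

Lemma geom_ge1 t n : 0 <= t -> 1 <= geom t n.+1.
Proof.
move=> t0; rewrite geomS lerDl mulr_ge0 //.
by apply: sumr_ge0 => i _; apply: exprn_ge0.
Qed.

(* The terms of index i and n - i have geometric mean s ^ n. *)
Lemma geom_amgm s n : 0 <= s -> n.+1%:R * s ^+ n <= geom (s ^+ 2) n.+1.
Proof.
move=> s0; have [N] := ubnP n; elim: N n => // N IH [|[|n]] ltN.
- by rewrite geomS /geom big_geq // mulr0 addr0 expr0 mulr1.
- rewrite !geomS /geom big_geq // mulr0 addr0 mulr1 expr1.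
  have : 0 <= (s - 1) ^+ 2 by apply: sqr_ge0.
  by rewrite sqrrB; lra.
- have {}IH := IH n (ltn_trans (ltnSn _) ltN).
  rewrite geomS /geom big_nat_recr //= -/(geom _ n.+1).
  have E2 : s ^+ 2 * (s ^+ 2) ^+ n.+1 = s ^+ n.+2 * s ^+ n.+2.
    by rewrite -exprS -exprM -exprD; congr (_ ^+ _); lia.
  have E3 : s ^+ n.+2 = s ^+ 2 * s ^+ n by rewrite -exprD.
  have H1 : s ^+ 2 * (n.+1%:R * s ^+ n) <= s ^+ 2 * geom (s ^+ 2) n.+1.
    by rewrite ler_wpM2l ?sqr_ge0.
  have H2 : 0 <= (s ^+ n.+2 - 1) ^+ 2 by apply: sqr_ge0.
  rewrite mulrDr E2 -[n.+3]addn2 natrD.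
  rewrite mulrCA -E3 in H1.
  move: (s ^+ n.+2) H1 H2 => y H1 H2.
  rewrite sqrrB in H2; lra.
Qed.

Lemma bernoulli (x : R) n : 0 <= 1 + x -> 1 + n%:R * x <= (1 + x) ^+ n.
Proof.
move=> x1; elim: n => [|n IH]; first by rewrite mul0r addr0 expr0.
have := ler_wpM2l x1 IH; rewrite -exprS; apply: le_trans.
have H : 0 <= n%:R * (x * x) by rewrite mulr_ge0 // -expr2 sqr_ge0.
rewrite -[n.+1]addn1 natrD; lra.
Qed.

(* These weights decrease with [n], so that Abel summation compares the sum of
   [chi n / n] with the Lambert series [(1 - t) * sum chi n * t^n / (1 - t^n)].
   The latter is [(1 - t) * sum_j dsum j * t^j], which is large for [t] close
   to 1 because [dsum] is nonnegative and at least 1 at squares.  Writing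
   [t = s^2] keeps square roots out of the AM-GM step. *)
Definition monsky_gap t n := n%:R^-1 - t ^+ n / geom t n.

Lemma monsky_gap_ge0 t n : 0 <= t <= 1 -> 0 <= monsky_gap t n.
Proof.
case/andP=> t0 t1; case: n => [|n]; first by rewrite /monsky_gap /geom big_geq // invr0 mulr0 subr0.
have S1 := geom_ge1 n t0.
rewrite /monsky_gap subr_ge0 ler_pdivrMr ?(lt_le_trans ltr01) // ler_pdivlMl ?ltr0Sn //.
rewrite -[n.+1 in X in X * _](subn0) mulr_natl -sumr_const_nat.
rewrite /geom !big_nat; apply: ler_sum => i /andP[_ lti].
by rewrite ler_wiXn2l // ltnW.
Qed.

(** With [g_n] for [geom t n], the subtracted terms differ by [t^n / (g_n g_(n+1))]. By [geom_amgm],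
    [g_n g_(n+1)] is at least [n (n+1) s^(2n-1)], hence at least [n (n+1) t^n], so this is at most
    [1/n - 1/(n+1)]. *)
Lemma monsky_gap_dec s n : 0 <= s <= 1 -> (0 < n)%N ->
  monsky_gap (s ^+ 2) n.+1 <= monsky_gap (s ^+ 2) n.
Proof.
case/andP=> s0 s1; case: n => // n _; set t := s ^+ 2.
have t0 : 0 <= t by apply: sqr_ge0.
have S1 := geom_ge1 n t0; have S2 := geom_ge1 n.+1 t0.
have p1 : 0 < geom t n.+1 by lra.
have p2 : 0 < geom t n.+2 by lra.
have E : t ^+ n.+1 / geom t n.+1 - t ^+ n.+2 / geom t n.+2 = t ^+ n.+1 / (geom t n.+1 * geom t n.+2).
  rewrite [t ^+ n.+2]exprS [geom t n.+2]geomS.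
  have : 1 + t * geom t n.+1 != 0 by rewrite -geomS lt0r_neq0.
  have : geom t n.+1 != 0 by rewrite lt0r_neq0.
  move: (geom t n.+1) (t ^+ n.+1) => g x g0 g1.
  by field; rewrite g0 g1.
have H1 := geom_amgm n s0; have H2 := geom_amgm n.+1 s0; rewrite -/t in H1 H2.
have H3 : t ^+ n.+1 * (n.+1%:R * n.+2%:R) <= geom t n.+1 * geom t n.+2.
  apply: le_trans (ler_pM _ _ H1 H2); rewrite ?mulr_ge0 ?exprn_ge0 //.
  rewrite mulrACA mulrC ler_wpM2l ?mulr_ge0 // -exprM -exprD ler_wiXn2l //; lia.
have H4 : t ^+ n.+1 / (geom t n.+1 * geom t n.+2) <= (n.+1%:R * n.+2%:R)^-1.
  by rewrite ler_pdivrMr ?mulr_gt0 // mulrC ler_pdivlMr ?mulr_gt0 ?ltr0Sn.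
have H5 : (n.+1%:R * n.+2%:R)^-1 = n.+1%:R^-1 - n.+2%:R^-1 :> R.
  have : n.+1%:R + 1 != 0 :> R by rewrite natr1 pnatr_eq0.
  have : n.+1%:R != 0 :> R by rewrite pnatr_eq0.
  rewrite -[n.+2]addn1 natrD; move: n.+1%:R => x x0 x1.
  by field; rewrite x0 x1.
rewrite /monsky_gap -subr_ge0 opprB [X in _ + X]addrC addrACA -H5.
by rewrite [X in _ + X]addrC -opprB E subr_ge0.
Qed.

End Geometric.

Section LowerBound.
Variable R : realFieldType.
Variables (m : nat) (chi : nat -> R).
Hypotheses (m_gt0 : (0 < m)%N) (chiP : real_char m chi).
Hypothesis chi_nontriv : exists u, chi u = -1.

Definition lsum (N : nat) : R := \sum_(1 <= n < N.+1) chi n / n%:R.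

Lemma lsum_gap (s : R) N : 0 <= s <= 1 ->
  - (m%:R * (1 - s ^+ 2)) <=
  lsum N - \sum_(1 <= n < N.+1) chi n * ((s ^+ 2) ^+ n / geom (s ^+ 2) n).
Proof.
move=> s01; set t := s ^+ 2.
have t01 : 0 <= t <= 1 by rewrite sqr_ge0 expr_le1 //; case/andP: s01.
rewrite -sumrB.
have -> : \sum_(1 <= i < N.+1) (chi i / i%:R - chi i * (t ^+ i / geom t i)) =
          \sum_(1 <= i < 1 + N) chi i * monsky_gap t i.
  by rewrite add1n; apply: eq_bigr => i _; rewrite /monsky_gap mulrBr.
have : `|\sum_(1 <= i < 1 + N) chi i * monsky_gap t i| <= m%:R * monsky_gap t 1.
  apply: abel_norm_le => [k _|i|i i1].
  - exact: rchar_sum_le.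
  - exact: monsky_gap_ge0.
  - exact: monsky_gap_dec.
rewrite {2}/monsky_gap expr1 /geom big_nat1 expr0 divr1 invr1 ler_norml.
by case/andP.
Qed.

Definition dsum (n : nat) : R := \sum_(d <- divisors n) chi d.

Lemma lambert_sum (t : R) N :
  \sum_(1 <= j < N.+1) dsum j * t ^+ j =
  \sum_(1 <= n < N.+1) chi n * \sum_(1 <= k < (N %/ n).+1) t ^+ (n * k).
Proof.
under eq_big_nat => j /andP[j1 jN].
  rewrite /dsum (@sum_divisors _ chi j N) ?j1 // big_distrl big_mkcond /=.
over.
rewrite exchange_big /=; apply: eq_big_nat => n /andP[n1 _].
rewrite -(@sum_multiples _ (fun j => t ^+ j) n N) // mulr_sumr big_mkcond /=.
by rewrite [RHS]big_mkcond.
Qed.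

(** The full geometric series in [t^n], times [1 - t], is [t^n / geom t n]; stopping at multiples of
    [n] up to [N] leaves a tail starting beyond [N]. *)
Lemma lambert_error (t : R) n N : 0 <= t <= 1 -> (0 < n)%N ->
  `|t ^+ n / geom t n - (1 - t) * \sum_(1 <= k < (N %/ n).+1) t ^+ (n * k)| <= t ^+ N.
Proof.
case/andP=> t0 t1 n0; have S1 : 1 <= geom t n by case: n n0 => // n _; apply: geom_ge1.
have Sp : 0 < geom t n by lra.
have G : forall K, (1 - t ^+ n) * \sum_(1 <= k < K.+1) t ^+ (n * k) = t ^+ n - t ^+ (n * K.+1).
  elim=> [|K IH]; first by rewrite big_geq // mulr0 muln1 subrr.
  by rewrite big_nat_recr //= mulrDr IH [(n * K.+2)%N]mulnS exprD; ring.
have -> : t ^+ n / geom t n - (1 - t) * \sum_(1 <= k < (N %/ n).+1) t ^+ (n * k) =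
          t ^+ (n * (N %/ n).+1) / geom t n.
  apply: (mulIf (lt0r_neq0 Sp)); rewrite mulrBl !mulfVK ?lt0r_neq0 //.
  by rewrite mulrAC geomE G; ring.
have le_N : (N <= n * (N %/ n).+1)%N by rewrite ltnW // mulnC ltn_ceil.
rewrite ger0_norm ?divr_ge0 ?exprn_ge0 //; last by lra.
rewrite ler_pdivrMr //; apply: le_trans (_ : t ^+ N <= _); first by rewrite ler_wiXn2l.
by rewrite ler_peMr // exprn_ge0.
Qed.

Lemma dsum_squares (t : R) K N : 0 <= t <= 1 -> (K * K <= N)%N ->
  K%:R * t ^+ (K * K) <= \sum_(1 <= j < N.+1) dsum j * t ^+ j.
Proof.
case/andP=> t0 t1 leKN.
have dsum0 j : (0 < j)%N -> 0 <= dsum j by case/(rchar_divisor_sum chiP).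
have dsum1 k : (0 < k)%N -> 1 <= dsum (k * k).
  move=> k0; have kk0 : (0 < k * k)%N by rewrite muln_gt0 k0.
  by have [_] := rchar_divisor_sum chiP kk0; apply=> p; rewrite lognM // addnn odd_double.
apply: (@le_trans _ _ (\sum_(1 <= k < K.+1) t ^+ (k * k))).
  have -> : K%:R * t ^+ (K * K) = \sum_(1 <= k < K.+1) t ^+ (K * K).
    by rewrite sumr_const_nat subSS subn0 mulr_natl.
  rewrite !big_nat.
  by apply: ler_sum => k /andP[_ kK]; rewrite ler_wiXn2l // leq_mul.
have -> : \sum_(1 <= k < K.+1) t ^+ (k * k) =
    \sum_(1 <= k < K.+1) \sum_(1 <= j < N.+1 | (j == k * k)%N) t ^+ j.
  apply: eq_big_nat => k /andP[k1 kK]; rewrite big_nat1_eq muln_gt0 k1 ltnS.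
  by rewrite (leq_trans _ leKN) // leq_mul.
rewrite (exchange_big_dep xpredT) //= !big_nat; apply: ler_sum => j /andP[j1 _].
case: (boolP (has (fun k => j == k * k)%N (index_iota 1 K.+1))) => [/hasP[k k_in /eqP Ej]|Hn].
  rewrite (eq_bigl (pred1 k)) => [|i]; last by rewrite /= Ej eq_sym eqn_sqr.
  move: k_in; rewrite mem_index_iota => k_in; rewrite big_nat1_eq k_in Ej.
  rewrite ler_peMl ?exprn_ge0 // dsum1 //; by case/andP: k_in.
rewrite big_hasC // mulr_ge0 ?exprn_ge0 ?dsum0 //.
Qed.

Lemma lsum_ge (t : R) N s : t = s ^+ 2 -> 0 <= s <= 1 ->
  (1 - t) * (\sum_(1 <= j < N.+1) dsum j * t ^+ j) - N%:R * t ^+ N - m%:R * (1 - t) <= lsum N.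
Proof.
move=> Et s01; have := lsum_gap N s01; rewrite -Et => H1.
have t01 : 0 <= t <= 1 by rewrite Et sqr_ge0 expr_le1 //; case/andP: s01.
have H2 : `|\sum_(1 <= n < N.+1) chi n * (t ^+ n / geom t n) -
            (1 - t) * \sum_(1 <= j < N.+1) dsum j * t ^+ j| <= N%:R * t ^+ N.
  rewrite lambert_sum mulr_sumr -sumrB.
  apply: (le_trans (ler_norm_sum _ _ _)).
  have -> : N%:R * t ^+ N = \sum_(1 <= n < N.+1) t ^+ N.
    by rewrite sumr_const_nat subSS subn0 mulr_natl.
  rewrite !big_nat; apply: ler_sum => n /andP[n1 _].
  rewrite [(1 - t) * _]mulrCA -mulrBr normrM -[leRHS]mul1r.
  by rewrite ler_pM ?normr_ge0 ?(rchar_norm_le1 chiP) // lambert_error.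
move: H2; rewrite ler_norml => /andP[H2 _].
move: H1 H2; move: (lsum _) (\sum_(_ <= _ < _) _ * (_ / _)) ((1 - t) * _) (_ * t ^+ _) => A B C D.
lra.
Qed.

Lemma lsum_lower : exists2 D : nat, (0 < D)%N &
  forall N, (D ^ 3 <= N)%N -> D%:R^-1 <= lsum N.
Proof.
(* With [s = 1 - 1/D] and [D = 4 K^2], Bernoulli gives [t^(K^2) >= 1/2], so the squares contribute
   [K / 2 = m + 2]. Abel summation loses [m (1 - t)] and truncation [1/D], which leaves
   [2 (1 - t) - 1/D >= 1/D]. *)
pose K := (2 * (m + 2))%N; pose D := (4 * (K * K))%N.
have K_gt0 : (0 < K)%N by rewrite /K; lia.
have D_gt0 : (0 < D)%N by rewrite /D muln_gt0; apply: (leq_mul K_gt0 K_gt0).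
exists D => // N leDN.
pose d : R := D%:R^-1.
have D_gt0' : 0 < D%:R :> R by rewrite ltr0n.
have d_gt0 : 0 < d by rewrite invr_gt0.
have Dd : D%:R * d = 1 by rewrite mulfV // lt0r_neq0.
have d_le1 : d <= 1 by rewrite invf_le1 // ler1n.
pose s := 1 - d; pose t := s ^+ 2.
have s01 : 0 <= s <= 1 by rewrite /s; lra.
have t01 : 0 <= t <= 1 by rewrite sqr_ge0 expr_le1 //; case/andP: s01.
apply: le_trans (lsum_ge N (erefl t) s01).
have KKN : (K * K <= N)%N.
  apply: leq_trans leDN; rewrite (leq_trans (_ : _ <= D)%N) // ?leq_pmull //.
  by rewrite -{1}(expn1 D) leq_pexp2l.
have H1 := dsum_squares t01 KKN.
have H2 : 2^-1 <= t ^+ (K * K).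
  rewrite -exprM; have := @bernoulli _ (- d) (2 * (K * K)) _; rewrite -/s => /(_ _)H.
  apply: le_trans (H _); last by case/andP: s01.
  have : D%:R * d = 2 * ((2 * (K * K))%:R * d) by rewrite mulrA -natrM mulnA.
  by rewrite Dd mulrN; lra.
have H3 : m%:R + 2 <= \sum_(1 <= j < N.+1) dsum j * t ^+ j.
  apply: le_trans H1; have -> : m%:R + 2 = K%:R * 2^-1 :> R.
    by rewrite /K natrM natrD; field.
  by rewrite ler_wpM2l.
(* Bernoulli bounds [s^N] by [1 / (N d)], hence [N t^N] by [1 / (N d^2)], at most [d] once
   [N >= D^3]. *)
have H4 : N%:R * t ^+ N <= d.
  have N_gt0 : (0 < N)%N by apply: leq_trans leDN; rewrite expn_gt0 D_gt0.
  have N_gt0' : 0 < N%:R :> R by rewrite ltr0n.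
  have Hs : s ^+ N * (1 + N%:R * d) <= 1.
    apply: (@le_trans _ _ (s ^+ N * (1 + d) ^+ N)).
      by rewrite ler_wpM2l ?exprn_ge0 ?bernoulli //; case/andP: s01 => // _ _; lra.
    rewrite -exprMn exprn_ile1 // /s.
      by have := mulr_ge0 (ltW d_gt0) (ltW d_gt0); nra.
    by have := mulr_ge0 (ltW d_gt0) (ltW d_gt0); nra.
  have Hs0 : 0 <= s ^+ N by rewrite exprn_ge0 //; case/andP: s01.
  have Hs1 : s ^+ N * (N%:R * d) <= 1.
    by apply: le_trans Hs; rewrite ler_wpM2l // lerDr.
  have Hs2 : t ^+ N * (N%:R * d) ^+ 2 <= 1.
    rewrite /t exprAC -exprMn exprn_ile1 // mulr_ge0 // mulr_ge0 // ltW //.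
  have HN : D%:R ^+ 3 <= N%:R :> R by rewrite -natrX ler_nat.
  have HN' : 1 <= N%:R * d ^+ 3.
    apply: (@le_trans _ _ (D%:R ^+ 3 * d ^+ 3)); first by rewrite -exprMn Dd expr1n.
    by apply: ler_wpM2r => //; apply/exprn_ge0/ltW.
  have : N%:R * t ^+ N * (N%:R * d ^+ 3) <= d.
    have -> : N%:R * t ^+ N * (N%:R * d ^+ 3) = d * (t ^+ N * (N%:R * d) ^+ 2) by ring.
    by rewrite -[leRHS]mulr1 ler_wpM2l // ltW.
  apply: le_trans; rewrite ler_peMr // mulr_ge0 ?ler0n // exprn_ge0 //; by case/andP: t01.
have H5 : d <= 1 - t.
  by rewrite /t /s expr2; nra.
have H6 : (1 - t) * (m%:R + 2) <= (1 - t) * \sum_(1 <= j < N.+1) dsum j * t ^+ j.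
  by rewrite ler_wpM2l //; lra.
move: H4 H5 H6; move: (\sum_(_ <= _ < _) _) (_ * t ^+ N) => A B H4 H5 H6.
rewrite -/d; lra.
Qed.

End LowerBound.

(** * Primes with prescribed values of real characters *)

Lemma bin_le_exp2 n k : ('C(n, k) <= 2 ^ n)%N.
Proof.
elim: n k => [|n IH] [|k]; rewrite ?bin0 ?bin0n ?expn_gt0 //.
by rewrite binS expnS mul2n -addnn leq_add.
Qed.

Section PrimesAndCharacters.
Variable R : realFieldType.
(* [lg] abstracts the natural logarithm on positive integers. *)
Variable lg : nat -> R.
Hypothesis lgM : forall a b, (0 < a)%N -> (0 < b)%N -> lg (a * b) = lg a + lg b.
Hypothesis lg_step : forall n, (0 < n)%N ->
  n.+1%:R^-1 <= lg n.+1 - lg n /\ lg n.+1 - lg n <= n%:R^-1.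

Lemma lg1 : lg 1 = 0.
Proof. by have := lgM (ltnSn 0) (ltnSn 0); rewrite muln1; lra. Qed.

Lemma lgX a k : (0 < a)%N -> lg (a ^ k) = k%:R * lg a.
Proof.
move=> a0; elim: k => [|k IH]; first by rewrite mul0r lg1.
by rewrite expnS lgM ?expn_gt0 ?a0 // IH -natr1 mulrDl mul1r addrC.
Qed.

Lemma lg_le a b : (0 < a)%N -> (a <= b)%N -> lg a <= lg b.
Proof.
move=> a0; elim: b => [|b IH]; first by rewrite leqn0 => /eqP Ea; rewrite Ea in a0.
rewrite leq_eqVlt => /predU1P[<- //|]; rewrite ltnS => ab.
have [H _] := lg_step (leq_trans a0 ab).
apply: le_trans (IH ab) _; rewrite -subr_ge0; apply: le_trans H.
by rewrite invr_ge0.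
Qed.

Lemma lg_ge0 n : (0 < n)%N -> 0 <= lg n.
Proof. by move=> n0; rewrite -lg1 lg_le. Qed.

Lemma lg2_le1 : lg 2 <= 1.
Proof. by have [_] := lg_step (ltnSn 0); rewrite lg1 invr1; lra. Qed.

(** * The von Mangoldt function and Chebyshev's bound *)

Definition mangoldt d := if size (primes d) == 1%N then lg (pdiv d) else 0.

Lemma mangoldt_ge0 d : 0 <= mangoldt d.
Proof. by rewrite /mangoldt; case: ifP => // _; rewrite lg_ge0 // pdiv_gt0. Qed.

Lemma mangoldt_pfactor p k : prime p -> mangoldt (p ^ k.+1) = lg p.
Proof. by move=> pp; rewrite /mangoldt primesX // primes_prime // pdiv_pfactor. Qed.

Lemma sum_mangoldt n : (0 < n)%N -> \sum_(d <- divisors n) mangoldt d = lg n.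
Proof.
have [N] := ubnP n; elim: N n => // N IH n; rewrite ltnS => le_nN n_gt0.
case: (leqP n 1) => [le_n1|n_gt1].
  have -> : n = 1%N by lia.
  by rewrite (_ : divisors 1 = [:: 1%N]) // big_seq1 lg1.
have p_pr := pdiv_prime n_gt1; set p := pdiv n in p_pr.
have [|n' pn' En] := @pfactor_coprime p n p_pr; first exact: n_gt0.
have n'_gt0 : (0 < n')%N by move: n_gt0; rewrite En muln_gt0 => /andP[].
have ndv : ~~ (p %| n')%N by rewrite -prime_coprime.
have lt_n'n : (n' < n)%N.
  rewrite En ltn_Pmulr // -{1}(exp1n (logn p n)) ltn_exp2r ?prime_gt1 //.
  by rewrite logn_gt0 mem_primes p_pr n_gt0 pdiv_dvd.
have {}IH := IH n' (leq_trans lt_n'n le_nN) n'_gt0.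
rewrite {1}En mulnC (perm_big _ (perm_divisors_pfactor _ p_pr n'_gt0 ndv)).
rewrite big_allpairs_dep -[iota 0 _]/(index_iota 0 (logn p n).+1) big_nat_recl //=.
under eq_bigr do rewrite expn0 mul1n; rewrite IH.
under eq_bigr => i _.
  rewrite (bigD1_seq 1%N) ?divisors_uniq ?divisor1 //= muln1 mangoldt_pfactor //.
  (* For [d > 1] the number [p^(i+1) d] has two distinct prime divisors. *)
  rewrite big1_seq => [|d /andP[d1 Hd]]; last first.
    have dn' : (d %| n')%N by rewrite dvdn_divisors.
    have d_gt1 : (1 < d)%N by have := dvdn_gt0 n'_gt0 dn'; case: d d1 {Hd dn'} => [|[]].
    rewrite /mangoldt; case Ep: (primes _) => [|r [|r' s]] //=.
    have x_gt0 : (0 < p ^ i.+1 * d)%N by rewrite muln_gt0 expn_gt0 prime_gt0 // ltnW.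
    have : p \in primes (p ^ i.+1 * d) by rewrite mem_primes p_pr x_gt0 dvdn_mulr // expnS dvdn_mulr.
    have : pdiv d \in primes (p ^ i.+1 * d).
      by rewrite mem_primes pdiv_prime // x_gt0 dvdn_mull // pdiv_dvd.
    rewrite Ep !inE => /eqP <- /eqP Epd.
    by case/negP: ndv; rewrite Epd (dvdn_trans (pdiv_dvd _)).
over.
rewrite addr0 sumr_const_nat subn0.
by rewrite [in RHS]En lgM ?pfactor_gt0 // lgX ?prime_gt0 // mulr_natl.
Qed.

Lemma lg_convolution (F : nat -> R) N :
  \sum_(1 <= n < N.+1) F n * lg n =
  \sum_(1 <= d < N.+1) mangoldt d * \sum_(1 <= k < (N %/ d).+1) F (d * k)%N.
Proof.
under eq_big_nat => n /andP[n1 nN].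
  rewrite -sum_mangoldt // (@sum_divisors _ _ n N) ?n1 // mulr_sumr big_mkcond /=.
over.
rewrite exchange_big /=; apply: eq_big_nat => d /andP[d1 _].
rewrite -(sum_multiples F N d1) mulr_sumr [RHS]big_mkcond.
by apply: eq_bigr => n _; case: ifP => // _; rewrite mulrC.
Qed.

Lemma sum_lg N :
  \sum_(1 <= n < N.+1) lg n = \sum_(1 <= d < N.+1) mangoldt d * (N %/ d)%:R.
Proof.
have := lg_convolution (fun _ => 1) N; under eq_bigr do rewrite mul1r; move=> ->.
by apply: eq_bigr => d _; rewrite sumr_const_nat subSS subn0.
Qed.

Lemma lg_fact N : lg N`! = \sum_(1 <= n < N.+1) lg n.
Proof.
elim: N => [|N IH]; first by rewrite big_geq // lg1.
by rewrite factS lgM ?fact_gt0 // [RHS]big_nat_recr //= IH addrC.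
Qed.

Definition chebyshev N := \sum_(1 <= d < N.+1) mangoldt d.

(** The central binomial coefficient is at most [4^n], and its logarithm weights [mangoldt d] by
    [floor(2n/d) - 2 floor(n/d)], which is nonnegative, and 1 for [n < d <= 2n]. *)
Lemma chebyshev_double n : chebyshev (2 * n) - chebyshev n <= 2 * n%:R.
Proof.
have H1 : lg (2 * n)`! - 2 * lg n`! <= 2 * n%:R.
  have <- : lg ('C(2 * n, n) * (n`! * n`!))%N = lg (2 * n)`!.
    by rewrite -(@bin_fact (2 * n) n) ?leq_pmull // mul2n -addnn addnK.
  rewrite !lgM ?muln_gt0 ?fact_gt0 // ?bin_gt0 ?leq_pmull //.
  have : lg 'C(2 * n, n) <= lg (2 ^ (2 * n)).
    by apply: lg_le (bin_le_exp2 _ _); rewrite bin_gt0 leq_pmull.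
  rewrite lgX // natrM; have := lg2_le1; have : 0 <= n%:R :> R by [].
  nra.
apply: le_trans H1; rewrite !lg_fact !sum_lg.
have ext (G : nat -> R) : \sum_(1 <= d < n.+1) G d =
    \sum_(1 <= d < (2 * n).+1) G d * (d <= n)%:R.
  rewrite [RHS](@big_cat_nat _ _ _ n.+1) //= ?ltnS ?leq_pmull // [X in _ = _ + X]big_nat.
  rewrite [X in _ = _ + X]big1 ?addr0 => [|d /andP[nd _]]; last by rewrite leqNgt nd mulr0.
  by apply: eq_big_nat => d /andP[_]; rewrite ltnS => ->; rewrite mulr1.
rewrite /chebyshev !ext mulr_sumr -!sumrB !big_nat; apply: ler_sum => d /andP[d0 d2].
rewrite -mulrA -[X in X - _]mulr1 -mulrBr mulrCA -mulrBr ler_wpM2l ?mangoldt_ge0 //.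
have H1 : (2 * (n %/ d) <= 2 * n %/ d)%N by rewrite leq_divRL // -mulnA leq_mul // leq_divM.
case: (leqP d n) => [le_dn|lt_nd].
  by rewrite subrr mulr1 subr_ge0 -natrM ler_nat.
by rewrite !mulr0 !subr0 ler1n divn_gt0.
Qed.

Lemma chebyshev_le N : chebyshev N <= 4 * N%:R.
Proof.
have chebyshev_mono a b : (a <= b)%N -> chebyshev a <= chebyshev b.
  move=> ab; rewrite [chebyshev b](@big_cat_nat _ _ _ a.+1) //= lerDl.
  by apply: sumr_ge0 => i _; apply: mangoldt_ge0.
have [n] := ubnP N; elim: n N => // n IH N; rewrite ltnS => le_Nn.
case: (leqP N 1) => [|N_gt1].
  case: N {le_Nn} => [|[|]] // _; first by rewrite /chebyshev big_geq // mulr0.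
  by rewrite /chebyshev big_nat1 /mangoldt /= mulr1.
(* Rounding up gives [N <= 2h], and the bound [4h + 2h] is at most [4N] since [3h <= 2N] for
   [N >= 2]. *)
pose h := uphalf N.
have h1 : (h < n)%N by rewrite /h; lia.
have h2 : (N <= 2 * h)%N by rewrite /h; lia.
have h3 : (3 * h <= 2 * N)%N by rewrite /h; lia.
have H1 := IH h h1; have H2 := chebyshev_double h; have H3 := chebyshev_mono _ _ h2.
have H4 : 3 * h%:R <= 2 * N%:R :> R by rewrite -!natrM ler_nat.
lra.
Qed.

Lemma lg_shift_dec n : (0 < n)%N -> (lg n.+1 + 1) / n.+1%:R <= (lg n + 1) / n%:R.
Proof.
move=> n0; have [_ H] := lg_step n0; have H0 := lg_ge0 n0.
have p : 0 < n%:R :> R by rewrite ltr0n.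
rewrite ler_pdivrMr ?ltr0Sn // mulrAC ler_pdivlMr //.
have : (lg n.+1 - lg n) * n%:R <= 1.
  by apply: le_trans (ler_wpM2r (ltW p) H) _; rewrite mulVf // lt0r_neq0.
rewrite -[n.+1%:R]natr1; move: (lg n.+1) (lg n) n%:R p H0 => x y z *; lra.
Qed.

Lemma lg_square_sum N : \sum_(1 <= n < N.+1) lg n / n%:R ^+ 2 <= 4.
Proof.
(* A discrete primitive modelled on [(log x + 1) / x]; the larger shift and the factor 2 absorb the
   discretisation, and [2 h(1) = 4]. *)
pose h n := (lg n + 2) / n%:R.
have h_dec n : (0 < n)%N -> lg n / n%:R ^+ 2 <= 2 * (h n - h n.+1).
  move=> n0; have [_ H] := lg_step n0; have H0 := lg_ge0 n0.
  have p : 0 < n%:R :> R by rewrite ltr0n.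
  have p1 : 1 <= n%:R :> R by rewrite ler1n.
  have {}H : (lg n.+1 - lg n) * n%:R <= 1.
    by apply: le_trans (ler_wpM2r (ltW p) H) _; rewrite mulVf // lt0r_neq0.
  rewrite /h -[n.+1%:R]natr1; move: (lg n.+1) (lg n) n%:R p p1 H0 H => x y z p p1 H0 H.
  have -> : 2 * ((y + 2) / z - (x + 2) / (z + 1)) = (2 * (y + 2 - (x - y) * z)) / (z * (z + 1)).
    by field; rewrite !lt0r_neq0 //; lra.
  rewrite ler_pdivrMr ?exprn_gt0 // mulrAC ler_pdivlMr; last by apply: mulr_gt0; lra.
  have H1 : 0 <= y * z * (z - 1) by rewrite !mulr_ge0 //; lra.
  have H2 : 0 <= (1 - (x - y) * z) * z ^+ 2 by rewrite mulr_ge0 ?sqr_ge0 //; lra.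
  have H3 : 0 <= z ^+ 2 by apply: sqr_ge0.
  rewrite expr2 in H2 H3 *; lra.
have : \sum_(1 <= n < N.+1) lg n / n%:R ^+ 2 <= 2 * (h 1%N - h N.+1).
  elim: N => [|N IH]; first by rewrite big_geq // subrr mulr0.
  rewrite big_nat_recr //=; move: (h_dec N.+1 isT) IH.
  move: (lg N.+1 / _) (\sum_(_ <= _ < _) _) (h 1%N) (h N.+1) (h N.+2) => *; lra.
have H1 : 0 <= h N.+1 by rewrite divr_ge0 // addr_ge0 // lg_ge0.
have : h 1%N = 2 by rewrite /h lg1 add0r divr1.
lra.
Qed.

Lemma geometric_tail (x : R) K : 0 <= x <= 2^-1 -> \sum_(2 <= k < K) x ^+ k <= 2 * x ^+ 2.
Proof.
case/andP=> x0 x1; case: (leqP K 2) => [K2|]; first by rewrite big_geq // mulr_ge0 ?sqr_ge0.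
case: K => [|[|K]] // _.
suff : \sum_(2 <= k < K.+2) x ^+ k <= 2 * x ^+ 2 - 2 * x ^+ K.+2.
  by have := exprn_ge0 K.+2 x0; lra.
elim: K => [|K IH]; first by rewrite big_geq // subrr.
rewrite big_nat_recr //=; have := exprn_ge0 K.+2 x0; rewrite [x ^+ K.+3]exprS.
by move: IH; move: (x ^+ K.+2) => y; nra.
Qed.

(** Proper prime powers are dominated by all [p^k] with [p, k >= 2], and the geometric series in [k]
    leaves twice the sum of [lg p / p^2]. *)
Lemma prime_power_sum N :
  \sum_(1 <= d < N.+1 | ~~ prime d) mangoldt d / d%:R <= 8.
Proof.
pose T p k := lg p * (p%:R^-1) ^+ k : R.
have T0 p k : (0 < p)%N -> 0 <= T p k.
  by move=> p0; rewrite mulr_ge0 ?exprn_ge0 ?invr_ge0 // lg_ge0.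
apply: (@le_trans _ _ (\sum_(2 <= p < N.+1) \sum_(2 <= k < N.+1) T p k)); last first.
  apply: (@le_trans _ _ (\sum_(2 <= p < N.+1) 2 * (lg p / p%:R ^+ 2))).
    rewrite !big_nat; apply: ler_sum => p /andP[p2 _]; rewrite /T -mulr_sumr.
    have p0 : (0 < p)%N by apply: ltnW.
    rewrite mulrCA ler_wpM2l ?lg_ge0 // -exprVn geometric_tail //.
    by rewrite invr_ge0 ler0n /= lef_pV2 ?posrE ?ltr0n // ler_nat.
  rewrite -mulr_sumr; have := lg_square_sum N.
  have [->|N0] := posnP N; first by rewrite big_geq // mulr0.
  by rewrite big_ltn // lg1 mul0r add0r => H; lra.
apply: (@le_trans _ _ (\sum_(1 <= d < N.+1) \sum_(2 <= p < N.+1)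
    \sum_(2 <= k < N.+1 | d == (p ^ k)%N) T p k)); last first.
  rewrite exchange_big /= !big_nat; apply: ler_sum => p /andP[p2 _].
  rewrite (exchange_big_dep xpredT) //= !big_nat; apply: ler_sum => k _.
  by rewrite big_nat1_eq; case: ifP => // _; apply: T0; apply: ltnW.
rewrite big_mkcond !big_nat; apply: ler_sum => d /andP[d1 dN].
have S0 : 0 <= \sum_(2 <= p < N.+1) \sum_(2 <= k < N.+1 | d == (p ^ k)%N) T p k.
  rewrite big_nat; apply: sumr_ge0 => p /andP[p2 _]; apply: sumr_ge0 => k _.
  by apply: T0; apply: ltnW.
case: ifP => // npr; rewrite /mangoldt.
case: ifP => [Hsz|_]; last by rewrite mul0r.
have d_gt1 : (1 < d)%N by case: d d1 Hsz {dN S0 npr} => [|[|]].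
have p_pr := pdiv_prime d_gt1; set p := pdiv d in p_pr *.
have Ed : d = (p ^ logn p d)%N.
  have [|d' pd' Ed] := @pfactor_coprime p d p_pr; first exact: d1.
  case: (leqP d' 1) => [d'1|d'1].
    by move: Ed d1; case: d' d'1 pd' => [|[|]] // _ _; [move=> -> | rewrite mul1n].
  have : p \in primes d by rewrite mem_primes p_pr d1 pdiv_dvd.
  have : pdiv d' \in primes d.
    by rewrite mem_primes pdiv_prime // d1 (dvdn_trans (pdiv_dvd _)) // [X in (_ %| X)%N]Ed dvdn_mulr.
  case: (primes d) Hsz => [|r []] // _; rewrite !inE => /eqP <- /eqP Epd.
  by move: pd'; rewrite prime_coprime // Epd pdiv_dvd.
have l2 : (1 < logn p d)%N.
  case: (logn p d) Ed => [|[|]] //; first by move=> E; rewrite E in d_gt1.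
  by rewrite expn1 => E; move: npr; rewrite E p_pr.
have pN : (p < N.+1)%N by apply: leq_ltn_trans dN; apply: dvdn_leq; rewrite ?pdiv_dvd.
have lN : (logn p d < N.+1)%N.
  by apply: leq_ltn_trans dN; rewrite {2}Ed ltnW // ltn_expl // prime_gt1.
have -> : lg p / d%:R = T p (logn p d) by rewrite /T {1}Ed natrX exprVn.
have mem_p : p \in index_iota 2 N.+1 by rewrite mem_index_iota prime_gt1.
have mem_k : logn p d \in index_iota 2 N.+1 by rewrite mem_index_iota l2.
rewrite (bigD1_seq p) ?iota_uniq //= -[leLHS]addr0 lerD //.
  rewrite (big_rem _ mem_k) /= -Ed eqxx lerDl; apply: sumr_ge0 => k _.
  by apply: T0; apply: prime_gt0.
rewrite big_seq_cond; apply: sumr_ge0 => q; rewrite mem_index_iota => /andP[/andP[q2 _] _].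
by apply: sumr_ge0 => k _; apply: T0; apply: ltnW.
Qed.

Definition prime_sum (f : nat -> R) N := \sum_(1 <= p < N.+1 | prime p) f p * (lg p / p%:R).

Lemma prime_sum_mangoldt f N : (forall d, `|f d| <= 1) ->
  `|\sum_(1 <= d < N.+1) mangoldt d * (f d / d%:R) - prime_sum f N| <= 8.
Proof.
move=> f1; apply: le_trans (prime_power_sum N).
rewrite (bigID prime) /= /prime_sum.
have -> : \sum_(1 <= p < N.+1 | prime p) f p * (lg p / p%:R) =
          \sum_(1 <= p < N.+1 | prime p) mangoldt p * (f p / p%:R).
  apply: eq_bigr => p pp; rewrite -{4}[p]expn1 mangoldt_pfactor //.
  by rewrite mulrCA.
rewrite addrAC subrr add0r; apply: le_trans (ler_norm_sum _ _ _) _.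
apply: ler_sum => d _; rewrite normrM normf_div (ger0_norm (mangoldt_ge0 d)).
by rewrite [`|d%:R|]ger0_norm // ler_wpM2l ?mangoldt_ge0 // ler_piMl ?invr_ge0.
Qed.

(** * Mertens' method for a nontrivial real character *)

Section Nontrivial.
Variables (m : nat) (chi : nat -> R).
Hypotheses (m_gt0 : (0 < m)%N) (chiP : real_char m chi).
Hypothesis chi_nontriv : exists u, chi u = -1.

(** [lg n / n] is not monotone from [n = 1], but [(lg n + 1) / n] is; Abel summation applies to it
    and to [1/n] separately. *)
Lemma rchar_lg_sum N : `|\sum_(1 <= n < N.+1) chi n / n%:R * lg n| <= 2 * m%:R.
Proof.
have H1 : `|\sum_(1 <= n < 1 + N) chi n * ((lg n + 1) / n%:R)| <= m%:R * ((lg 1 + 1) / 1%:R).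
  apply: (@abel_norm_le _ chi (fun n => (lg n + 1) / n%:R)) => [k _|i|i i1].
  - exact: rchar_sum_le.
  - case: i => [|i]; first by rewrite invr0 mulr0.
    by rewrite divr_ge0 // addr_ge0 // lg_ge0.
  - exact: lg_shift_dec.
have H2 : `|\sum_(1 <= n < 1 + N) chi n * n%:R^-1| <= m%:R * 1%:R^-1.
  apply: (@abel_norm_le _ chi (fun n => n%:R^-1)) => [k _|i|i i1].
  - exact: rchar_sum_le.
  - by rewrite invr_ge0.
  - by rewrite lef_pV2 ?posrE ?ltr0n // ler_nat.
have -> : \sum_(1 <= n < N.+1) chi n / n%:R * lg n =
   \sum_(1 <= n < 1 + N) chi n * ((lg n + 1) / n%:R) - \sum_(1 <= n < 1 + N) chi n * n%:R^-1.
  by rewrite add1n -sumrB; apply: eq_bigr => n _; ring.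
apply: le_trans (ler_normB _ _) _; move: H1 H2.
rewrite lg1 add0r invr1 mulr1; lra.
Qed.

Lemma lsum_tail K N : (K <= N)%N -> `|lsum chi K - lsum chi N| <= m%:R / K.+1%:R.
Proof.
move=> KN; rewrite distrC /lsum [X in X - _](@big_cat_nat _ _ _ K.+1) //= addrAC subrr add0r.
rewrite -(subnKC KN) -addSn.
apply: (@abel_norm_le _ chi (fun n => n%:R^-1)) => [k _|i|i i1].
- exact: rchar_sum_le.
- by rewrite invr_ge0.
- by rewrite lef_pV2 ?posrE ?ltr0n ?ler_nat // (leq_trans _ i1).
Qed.

(* Since [lg] is the divisor sum of [mangoldt], the sum of [chi n * lg n / n] is
   that of [mangoldt d * chi d / d * lsum chi (N / d)], and replacing [N / d] by
   [N] costs [O(d / N)] in each term, hence [O(1)] by Chebyshev's bound. *)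
Lemma rchar_mangoldt_sum N : (0 < N)%N ->
  `|lsum chi N * \sum_(1 <= d < N.+1) mangoldt d * (chi d / d%:R)| <= 6 * m%:R.
Proof.
move=> N0; have N0' : 0 < N%:R :> R by rewrite ltr0n.
have E1 : \sum_(1 <= n < N.+1) chi n / n%:R * lg n =
          \sum_(1 <= d < N.+1) mangoldt d * (chi d / d%:R) * lsum chi (N %/ d).
  rewrite (lg_convolution (fun n => chi n / n%:R)); apply: eq_bigr => d _.
  rewrite -mulrA; congr (_ * _); rewrite mulr_sumr; apply: eq_bigr => k _.
  by rewrite (rcharM chiP) natrM invfM mulrACA.
have E2 : `|\sum_(1 <= d < N.+1) mangoldt d * (chi d / d%:R) * (lsum chi (N %/ d) - lsum chi N)|
          <= 4 * m%:R.
  apply: le_trans (ler_norm_sum _ _ _) _.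
  apply: (@le_trans _ _ (\sum_(1 <= d < N.+1) mangoldt d * (m%:R / N%:R))).
    rewrite !big_nat; apply: ler_sum => d /andP[d1 dN].
    rewrite !normrM (ger0_norm (mangoldt_ge0 d)) -mulrA ler_wpM2l ?mangoldt_ge0 //.
    have d0 : 0 < d%:R :> R by rewrite ltr0n.
    apply: (@le_trans _ _ (d%:R^-1 * (m%:R / (N %/ d).+1%:R))).
      apply: ler_pM; rewrite ?mulr_ge0 ?normr_ge0 //; last exact/lsum_tail/leq_div.
      rewrite [`|d%:R^-1|]ger0_norm ?invr_ge0 ?ler0n // ler_piMl ?invr_ge0 ?ler0n //.
      exact: (rchar_norm_le1 chiP).
    rewrite mulrCA ler_wpM2l ?mangoldt_ge0 // -invfM lef_pV2 ?posrE ?mulr_gt0 ?ltr0Sn //.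
    by rewrite -natrM ler_nat mulnC ltnW // ltn_ceil.
  rewrite -mulr_suml; have H := chebyshev_le N.
  have H0 : 0 <= m%:R / N%:R :> R by rewrite divr_ge0.
  apply: le_trans (ler_wpM2r H0 H) _.
  by rewrite -mulrA [N%:R * _]mulrCA mulfV ?mulr1 // lt0r_neq0.
have -> : lsum chi N * \sum_(1 <= d < N.+1) mangoldt d * (chi d / d%:R) =
  \sum_(1 <= n < N.+1) chi n / n%:R * lg n -
  \sum_(1 <= d < N.+1) mangoldt d * (chi d / d%:R) * (lsum chi (N %/ d) - lsum chi N).
  rewrite E1 -sumrB mulr_sumr; apply: eq_bigr => d _.
  by rewrite mulrBr opprB addrCA subrr addr0 mulrC.
apply: le_trans (ler_normB _ _) _.
have -> : 6 * m%:R = 2 * m%:R + 4 * m%:R :> R by ring.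
by apply: lerD => //; apply: rchar_lg_sum.
Qed.

Lemma rchar_prime_sum : exists C N0 : nat, forall N, (N0 <= N)%N -> `|prime_sum chi N| <= C%:R.
Proof.
have [D D0 HD] := lsum_lower m_gt0 chiP chi_nontriv.
(* [6 m] is divided by the lower bound [1/D] of [lsum], valid from [D^3] on; 8 pays for proper prime
   powers. *)
exists (6 * m * D + 8)%N, (D ^ 3)%N => N leN.
have N0 : (0 < N)%N by apply: leq_trans leN; rewrite expn_gt0 D0.
have H1 := rchar_mangoldt_sum N0; have H2 := HD N leN.
have H3 := prime_sum_mangoldt N (rchar_norm_le1 chiP).
have D0' : 0 < D%:R :> R by rewrite ltr0n.
have L0 : 0 < lsum chi N by apply: lt_le_trans H2; rewrite invr_gt0.
have {}H1 : `|\sum_(1 <= d < N.+1) mangoldt d * (chi d / d%:R)| <= 6 * m%:R * D%:R.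
  rewrite normrM (ger0_norm (ltW L0)) in H1.
  have := ler_wpM2r (normr_ge0 (\sum_(1 <= d < N.+1) mangoldt d * (chi d / d%:R))) H2.
  move=> /le_trans/(_ H1); rewrite mulrC ler_pdivrMr //.
rewrite natrD !natrM.
have := ler_normD (\sum_(1 <= d < N.+1) mangoldt d * (chi d / d%:R))
   (prime_sum chi N - \sum_(1 <= d < N.+1) mangoldt d * (chi d / d%:R)).
by rewrite addrC subrK => H4; rewrite distrC in H3; lra.
Qed.
End Nontrivial.

(** Replace [floor(N/d)] by [N/d] in [lg N! >= N lg N - N]; of the 9, one comes from this factorial
    bound and 8 from prime powers. *)
Lemma mertens_ge N : (0 < N)%N -> lg N - 9 <= prime_sum (fun _ => 1) N.
Proof.
move=> N0; have H1 : N%:R * lg N - N%:R <= \sum_(1 <= n < N.+1) lg n.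
  elim: N {N0} => [|N IH]; first by rewrite big_geq // mul0r subrr.
  rewrite big_nat_recr //= -lerBlDr; apply: le_trans IH.
  case: N => [|N]; first by rewrite lg1; lra.
  have [_ H] := lg_step (ltn0Sn N).
  have : (lg N.+2 - lg N.+1) * N.+1%:R <= 1.
    by apply: le_trans (ler_wpM2r (ler0n _ _) H) _; rewrite mulVf // pnatr_eq0.
  rewrite -[N.+2%:R]natr1; move: (lg N.+2) (lg N.+1) N.+1%:R => x y z; lra.
have N0' : 0 < N%:R :> R by rewrite ltr0n.
have H2 : \sum_(1 <= n < N.+1) lg n <= N%:R * \sum_(1 <= d < N.+1) mangoldt d * (1 / d%:R).
  rewrite sum_lg mulr_sumr !big_nat; apply: ler_sum => d /andP[d1 _].
  rewrite mulrCA ler_wpM2l ?mangoldt_ge0 // mul1r ler_pdivlMr ?ltr0n // -natrM ler_nat.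
  exact: leq_divM.
have H3 : lg N - 1 <= \sum_(1 <= d < N.+1) mangoldt d * (1 / d%:R).
  rewrite -(ler_pM2l N0') mulrBr mulr1; exact: le_trans H1 H2.
have := prime_sum_mangoldt (f := fun _ => 1) N _; rewrite normr1 lexx => /(_ (fun _ => isT)).
rewrite ler_norml => /andP[_]; lra.
Qed.

(** * A prime sharing the character values of a given unit *)

Variables (m c : nat).
Hypotheses (m_gt0 : (0 < m)%N) (cop_cm : coprime c m).

Definition principal (a : nat) : R := (coprime a m)%:R.

Lemma principalP : real_char m principal.
Proof.
split=> [a b|a|a|a]; rewrite /principal.
- by rewrite coprimeMl -natrM mulnb.
- by rewrite /coprime gcdnC gcdnDr gcdnC.
- by move=> ->; left.
- by move=> /negPf ->.
Qed.

Lemma lg_le_id n : (0 < n)%N -> lg n <= n%:R.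
Proof.
elim: n => // [[|n]] IH _; first by rewrite lg1.
have [_ H] := lg_step (ltn0Sn n); have {}IH := IH isT.
have : n.+1%:R^-1 <= 1 :> R by rewrite invf_le1 ?ler1n ?ltr0n.
rewrite -[n.+2%:R]natr1; move: n.+1%:R n.+1%:R^-1 (lg n.+1) (lg n.+2) H IH => *; lra.
Qed.

Lemma prime_sum_principal N : (0 < N)%N -> lg N - (9 + m)%:R <= prime_sum principal N.
Proof.
move=> N0; have := mertens_ge N0.
have Hm : \sum_(1 <= p < N.+1) (p <= m)%:R <= m%:R :> R.
  suff -> : \sum_(1 <= p < N.+1) (p <= m)%:R = (minn N m)%:R :> R by rewrite ler_nat geq_minr.
  elim: N {N0} => [|N IH]; first by rewrite big_geq // min0n.
  by rewrite big_nat_recr //= IH -natrD; congr (_%:R); case: leqP; lia.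
have : prime_sum (fun=> 1) N - prime_sum principal N <= m%:R.
  apply: le_trans Hm; rewrite -sumrB big_mkcond !big_nat; apply: ler_sum => p /andP[p1 _].
  case: ifP => [pp|_]; last by [].
  rewrite -mulrBl /principal prime_coprime //.
  have p0 : 0 < p%:R :> R by rewrite ltr0n.
  case: (boolP (p %| m)%N) => /= [/(dvdn_leq m_gt0) ->|_]; last by rewrite subrr mul0r.
  by rewrite subr0 mul1r ler_pdivrMr // mul1r lg_le_id.
rewrite natrD; lra.
Qed.

Variable X : nat -> nat -> R.

(* The product is nonzero only if [X i p = X i c] for all [i < r]; peeling off its
   last factor writes the sum as two sums with one factor fewer. *)
Definition twisted_sum (psi : nat -> R) r N :=
  psi c * prime_sum (fun p => psi p * \prod_(0 <= i < r) (1 + X i c * X i p)) N.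

Lemma twisted_sum0 psi N : twisted_sum psi 0 N = psi c * prime_sum psi N.
Proof.
congr (_ * _); apply: eq_bigr => p _; by rewrite big_geq // mulr1.
Qed.

Lemma twisted_sumS psi r N : twisted_sum psi r.+1 N =
  twisted_sum psi r N + twisted_sum (fun a => psi a * X r a) r N.
Proof.
rewrite /twisted_sum /prime_sum !mulr_sumr -big_split /=.
apply: eq_bigr => p _; rewrite big_nat_recr //=; ring.
Qed.

Lemma real_char_dichotomy psi : real_char m psi ->
  (exists u, psi u = -1) \/ psi =1 principal.
Proof.
move=> psiP; case: (boolP [exists u : 'I_m, psi u == -1]) => [/existsP[u /eqP]|/existsPn H].
  by left; exists u.
right=> a; rewrite /principal; case: (boolP (coprime a m)) => [|/(rchar_nunit psiP)] //=.
case/(rchar_unit psiP) => // Ea; have := H (Ordinal (ltn_pmod a m_gt0)).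
by rewrite /= (rchar_mod psiP) Ea eqxx.
Qed.

(** Some products of the [X i] may be principal. The weight [psi c] is then 1 and the term grows
    like [lg N], so such coincidences only help and a one-sided bound is the right invariant. *)
Lemma twisted_sum_ge r : (forall i, (i < r)%N -> real_char m (X i)) ->
  forall psi, real_char m psi -> exists C N0 : nat, forall N, (N0 <= N)%N ->
    - C%:R <= twisted_sum psi r N.
Proof.
elim: r => [|r IH] HX psi psiP; last first.
  have HX' i : (i < r)%N -> real_char m (X i) by move=> ir; apply: HX; apply: ltnW.
  have [C1 [N1 H1]] := IH HX' psi psiP.
  have [C2 [N2 H2]] := IH HX' _ (real_char_mul psiP (HX r (ltnSn r))).
  exists (C1 + C2)%N, (maxn N1 N2) => N; rewrite geq_max => /andP[/H1 {}H1 /H2 {}H2].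
  by rewrite twisted_sumS natrD opprD lerD.
case: (real_char_dichotomy psiP) => [nt|E].
  have [C [N0 H]] := rchar_prime_sum m_gt0 psiP nt.
  exists C, N0 => N /H; rewrite twisted_sum0.
  case: (rchar_unit psiP cop_cm) => ->; rewrite ?mul1r ?mulN1r ler_norml; lra.
exists (9 + m)%N, 1%N => N N0; rewrite twisted_sum0 E /principal cop_cm mul1r.
have -> : prime_sum psi N = prime_sum principal N by apply: eq_bigr => p _; rewrite E.
have := prime_sum_principal N0; have := lg_ge0 N0; lra.
Qed.

Lemma twisted_sum_principal r : (forall i, (i < r)%N -> real_char m (X i)) ->
  exists C N0 : nat, forall N, (N0 <= N)%N -> lg N - C%:R <= twisted_sum principal r N.
Proof.
elim: r => [|r IH] HX.
  exists (9 + m)%N, 1%N => N N0; rewrite twisted_sum0 {1}/principal cop_cm mul1r.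
  exact: prime_sum_principal.
have HX' i : (i < r)%N -> real_char m (X i) by move=> ir; apply: HX; apply: ltnW.
have [C1 [N1 H1]] := IH HX'.
have [C2 [N2 H2]] := twisted_sum_ge HX' (real_char_mul principalP (HX r (ltnSn r))).
exists (C1 + C2)%N, (maxn N1 N2) => N; rewrite geq_max => /andP[/H1 {}H1 /H2 {}H2].
by rewrite twisted_sumS natrD opprD addrA lerD.
Qed.

Lemma exists_prime_characters r : (forall i, (i < r)%N -> real_char m (X i)) ->
  exists p, [/\ prime p, coprime p m & forall i, (i < r)%N -> X i p = X i c].
Proof.
move=> HX; have [C [N0 H]] := twisted_sum_principal HX.
(* As [lg 2 >= 1/2], this [k] makes [lg N] exceed [C], and also [N >= N0]. *)
pose k := (2 * C.+1 + N0)%N; pose N := (2 ^ k)%N.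
have NN0 : (N0 <= N)%N by apply: leq_trans (ltnW (ltn_expl k (ltnSn 1))); rewrite leq_addl.
have lgN : C.+1%:R <= lg N.
  rewrite /N lgX //.
  have [H2 _] := lg_step (ltnSn 0); rewrite lg1 subr0 in H2.
  apply: (@le_trans _ _ ((2 * C.+1)%:R * 2^-1)); first by rewrite natrM mulrAC mulfV ?mul1r ?pnatr_eq0.
  by rewrite ler_pM ?invr_ge0 // ler_nat leq_addr.
pose good p := [&& prime p, coprime p m & [forall i : 'I_r, X i p == X i c]].
case: (boolP (has good (index_iota 1 N.+1))) => [/hasP[p _ /and3P[pp cp /forallP/= Hp]]|/hasPn Hn].
  by exists p; split=> // i ir; apply/eqP/(Hp (Ordinal ir)).
have := H N NN0; rewrite /twisted_sum /prime_sum.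
rewrite big1_seq ?mulr0; first by rewrite -natr1 in lgN; lra.
move=> p /andP[pp /Hn]; rewrite /good pp /=.
rewrite /principal; case: (boolP (coprime p m)) => cp; last by rewrite !mul0r.
rewrite negb_forall => /existsP[i Hi].
have ir := ltn_ord i.
rewrite mul1r (bigD1_seq (val i)) ?iota_uniq ?mem_index_iota //=.
suff -> : 1 + X i c * X i p = 0 by rewrite !mul0r.
case: (rchar_unit (HX i ir) cp) (rchar_unit (HX i ir) cop_cm) Hi => -> [] ->; rewrite ?eqxx //.
  by rewrite mulr1 subrr.
by rewrite mul1r subrr.
Qed.
End PrimesAndCharacters.

(** * Quadratic reciprocity *)

Section GaussLemma.
Variable p : nat.
Hypotheses (p_pr : prime p) (p_odd : odd p).
Let h := p./2.
Let Ep : p = h.*2.+1.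
Proof. by rewrite /h -{1}[p]odd_double_half p_odd. Qed.
Let h_gt0 : (0 < h)%N.
Proof. by have := prime_gt1 p_pr; rewrite Ep; case: h. Qed.

Lemma Fp_natr_eq0 a : ((a%:R : 'F_p) == 0) = (p %| a)%N.
Proof. by rewrite -(dvdn_pcharf (pchar_Fp p_pr)). Qed.

Lemma Fp_natr_mod a : (a %% p)%:R = a%:R :> 'F_p.
Proof. by rewrite [in RHS](divn_eq a p) natrD natrM pchar_Fp_0 // mulr0 add0r. Qed.

Lemma Fp_natr_inj a b : (a < p)%N -> (b < p)%N -> a%:R = b%:R :> 'F_p -> a = b.
Proof.
wlog ab : a b / (a <= b)%N.
  by move=> W ap bp E; case/orP: (leq_total a b) => ?; [|symmetry]; apply: W.
move=> ap bp /esym/eqP; rewrite -subr_eq0 -natrB // Fp_natr_eq0 => /dvdn_leq H.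
by case: (posnP (b - a)) => [|/H]; lia.
Qed.

Definition residue a k := (a * k %% p)%N.
Definition residue_abs a k := if (residue a k <= h)%N then residue a k else (p - residue a k)%N.
Definition gauss_count a := (\sum_(1 <= k < h.+1) (h < residue a k))%N.

Variable a : nat.
Hypothesis pa : ~~ (p %| a)%N.

Lemma residue_lt k : (residue a k < p)%N.
Proof. by rewrite ltn_mod prime_gt0. Qed.

Lemma residue_abs_range k : (0 < k <= h)%N -> (0 < residue_abs a k <= h)%N.
Proof.
move=> /andP[k0 kh]; have := residue_lt k.
have : (0 < residue a k)%N.
  rewrite lt0n; apply: contra pa => r0; have : (p %| a * k)%N by [].
  by rewrite Euclid_dvdM // => /orP[//|/dvdn_leq]; lia.
rewrite /residue_abs; case: (leqP (residue a k) h); lia.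
Qed.

Lemma residue_absE k :
  (residue_abs a k)%:R = (-1) ^+ (h < residue a k)%N * (a * k)%:R :> 'F_p.
Proof.
rewrite /residue_abs; case: leqP => _; first by rewrite expr0 mul1r /residue Fp_natr_mod.
rewrite natrB ?(ltnW (residue_lt k)) // pchar_Fp_0 // sub0r expr1 mulN1r.
by rewrite /residue Fp_natr_mod.
Qed.

Lemma residue_abs_inj k l : (0 < k <= h)%N -> (0 < l <= h)%N ->
  residue_abs a k = residue_abs a l -> k = l.
Proof.
move=> /andP[k0 kh] /andP[l0 lh] E.
have : (residue_abs a k)%:R ^+ 2 = (residue_abs a l)%:R ^+ 2 :> 'F_p by rewrite E.
rewrite !residue_absE !exprMn !sqrr_sign !mul1r.
rewrite !natrM !exprMn => /mulfI; rewrite expf_eq0 /= Fp_natr_eq0 => /(_ pa)/eqP.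
rewrite eqf_sqr => /orP[/eqP|]; first by apply: Fp_natr_inj; lia.
rewrite -subr_eq0 opprK -natrD Fp_natr_eq0 => /dvdn_leq; lia.
Qed.

Lemma perm_residue_abs : perm_eq [seq residue_abs a k | k <- index_iota 1 h.+1] (index_iota 1 h.+1).
Proof.
have U : uniq [seq residue_abs a k | k <- index_iota 1 h.+1].
  rewrite map_inj_in_uniq ?iota_uniq // => k l; rewrite !mem_index_iota !ltnS.
  exact: residue_abs_inj.
apply: uniq_perm; rewrite ?iota_uniq //.
have S : {subset [seq residue_abs a k | k <- index_iota 1 h.+1] <= index_iota 1 h.+1}.
  move=> x /mapP[k]; rewrite !mem_index_iota !ltnS => /residue_abs_range H ->; exact: H.
by have [|//] := uniq_min_size U S; rewrite size_map.
Qed.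

(** Multiplying 1, ..., [h] by [a] permutes them up to [gauss_count a] signs; cancel their
    product. *)
Lemma gauss_lemma : (a%:R : 'F_p) ^+ h = (-1) ^+ gauss_count a.
Proof.
have P0 : \prod_(1 <= k < h.+1) (k%:R : 'F_p) != 0.
  rewrite prodf_seq_neq0; apply/allP => k; rewrite mem_index_iota /= => /andP[k0 kh].
  by rewrite Fp_natr_eq0; apply/negP => /dvdn_leq; lia.
have EP : \prod_(1 <= k < h.+1) (k%:R : 'F_p) =
    (-1) ^+ gauss_count a * ((a%:R : 'F_p) ^+ h * \prod_(1 <= k < h.+1) k%:R).
  rewrite -{1}(perm_big _ perm_residue_abs) big_map /=.
  under eq_bigr do rewrite residue_absE natrM.
  by rewrite !big_split /= prodr_const_nat subSS subn0 -expr_sum.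
apply: (mulIf P0); rewrite [in RHS]EP mulrA -exprD addnn -mul2n exprM sqrrN expr1n.
by rewrite expr1n mul1r.
Qed.
End GaussLemma.

Section Parity.
Variable p : nat.
Hypotheses (p_pr : prime p) (p_odd : odd p).
Let h := p./2.
Let Ep : p = h.*2.+1.
Proof. by rewrite /h -{1}[p]odd_double_half p_odd. Qed.

(** Sum [a k = p floor(a k / p) + residue] modulo 2; passing to the absolute residue, a permutation
    of 1, ..., [h], changes the parity once per counted [k]. For [a = 2] the quotients vanish; for
    odd [a] the outer sums cancel. *)
Lemma gauss_count_parity a : ~~ (p %| a)%N ->
  odd (gauss_count p a) = odd (\sum_(1 <= k < h.+1) a * k) (+)
    odd (\sum_(1 <= k < h.+1) (a * k) %/ p) (+) odd (\sum_(1 <= k < h.+1) k).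
Proof.
move=> pa; rewrite -[X in _ = X]addbC.
have E1 : (\sum_(1 <= k < h.+1) a * k =
  p * (\sum_(1 <= k < h.+1) (a * k) %/ p) + \sum_(1 <= k < h.+1) residue p a k)%N.
  rewrite big_distrr -big_split /=; apply: eq_bigr => k _.
  by rewrite {1}(divn_eq (a * k) p) mulnC.
have E2 : (\sum_(1 <= k < h.+1) residue p a k +
   2 * (\sum_(1 <= k < h.+1) (h < residue p a k) * residue_abs p a k) =
   \sum_(1 <= k < h.+1) residue_abs p a k + p * gauss_count p a)%N.
  rewrite /gauss_count !big_distrr -!big_split /=; apply: eq_bigr => k _.
  rewrite /residue_abs -/h; have lt_rp := residue_lt p_pr a k.
  by case: (leqP (residue p a k) h) => _; rewrite ?mul0n ?mul1n ?muln0 ?muln1 ?addn0 //; lia.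
have E3 : (\sum_(1 <= k < h.+1) residue_abs p a k = \sum_(1 <= k < h.+1) k)%N.
  by rewrite -[RHS](perm_big _ (perm_residue_abs p_pr p_odd pa)) big_map.
have := congr1 odd E1; have := congr1 odd E2; rewrite E3 !oddD !oddM p_odd /= addbF.
by do 6!case: (odd _).
Qed.

Lemma gauss_count2 : odd (gauss_count p 2) = odd (h * h.+1)./2.
Proof.
have h0 : (0 < h)%N by have := prime_gt1 p_pr; rewrite Ep; case: h.
rewrite gauss_count_parity; last by apply/negP => /dvdn_leq; lia.
rewrite -big_distrr oddM /= [X in odd X (+) _]big1_seq => [|k]; last first.
  by rewrite mem_index_iota => /andP[_ /andP[k0 kh]]; rewrite divn_small //; lia.
rewrite /=; congr odd; have -> : (h * h.+1 = 2 * \sum_(1 <= k < h.+1) k)%N.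
  elim: (h) => [|n IH]; first by rewrite big_geq.
  rewrite big_nat_recr //= mulnDr -IH; lia.
by rewrite mul2n doubleK.
Qed.
End Parity.

(* Eisenstein: the two parities count the lattice points of a rectangle on either
   side of its diagonal. *)
Lemma gauss_count_reciprocity p q : prime p -> prime q -> odd p -> odd q -> p != q ->
  odd (gauss_count p q) (+) odd (gauss_count q p) = odd (p./2 * q./2).
Proof.
have half p' : odd p' -> p' = (p'./2).*2.+1 by move=> o; rewrite -{1}[p']odd_double_half o.
have nd p' q' : prime p' -> prime q' -> p' != q' -> ~~ (p' %| q')%N.
  by move=> p'P q'P; rewrite dvdn_prime2.
have E p' q' : prime p' -> prime q' -> odd p' -> odd q' -> p' != q' ->
  odd (gauss_count p' q') =
  odd (\sum_(1 <= k < p'./2.+1) \sum_(1 <= l < q'./2.+1) (p' * l <= q' * k))%N.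
  move=> p'P q'P po qo pq; rewrite gauss_count_parity ?nd // -big_distrr oddM qo /=.
  rewrite addbAC addbb /=; congr odd; apply: eq_big_nat => k /andP[k0 kp].
  have le_h : ((q' * k) %/ p' <= q'./2)%N.
    rewrite -ltnS ltn_divLR ?prime_gt0 //; have := half _ po; have := half _ qo; nia.
  have -> : (\sum_(1 <= l < q'./2.+1) (p' * l <= q' * k) =
            \sum_(1 <= l < q'./2.+1) (l <= (q' * k) %/ p'))%N.
    by apply: eq_bigr => l _; rewrite leq_divRL ?prime_gt0 // mulnC.
  elim: (q'./2) ((q' * k) %/ p')%N le_h => [|n IH] d; first by rewrite leqn0 big_geq => // /eqP.
  rewrite leq_eqVlt => /predU1P[->|dn].
    rewrite (eq_big_nat _ _ (F2 := fun=> 1%N)); first by rewrite sum_nat_const_nat; lia.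
    by move=> i /andP[_]; rewrite ltnS => ->.
  by rewrite big_nat_recr //= -IH // leqNgt dn addn0.
move=> pP qP po qo pq; rewrite E // E // 1?eq_sym // -oddD; congr odd.
rewrite [X in (_ + X)%N]exchange_big /= -big_split /=.
rewrite (eq_big_nat _ _ (F2 := fun=> q./2)) ?sum_nat_const_nat ?subSS ?subn0 // => k /andP[k0 kp].
rewrite -big_split /= (eq_big_nat _ _ (F2 := fun=> 1%N)) ?sum_nat_const_nat ?subSS ?subn0 ?muln1 //.
move=> l /andP[l0 lq]; case: ltngtP => // Elk.
have : (p %| q * k)%N by rewrite -Elk dvdn_mulr.
rewrite Euclid_dvdM // (negPf (nd _ _ pP qP pq)) /= => /dvdn_leq.
have := half _ po; lia.
Qed.

(** With the Gauss count as definition, reciprocity and the value at 2 are parity statements;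
    Euler's criterion [legendre_Fp] then brings multiplicativity back from the field. *)
Definition legendre (p a : nat) : int := if (p %| a)%N then 0 else (-1) ^+ gauss_count p a.

Definition chi4 (a : nat) : int := nth 0 [:: 0; 1; 0; -1] (a %% 4).
Definition chi8 (a : nat) : int := nth 0 [:: 0; 1; 0; -1; 0; -1; 0; 1] (a %% 8).

Lemma chi4M a b : chi4 (a * b) = chi4 a * chi4 b.
Proof.
rewrite /chi4 -modnMm.
have : all (fun i => all (fun j => chi4 (i * j) == chi4 i * chi4 j) (iota 0 4)) (iota 0 4) by [].
move=> /allP/(_ (a %% 4)%N); rewrite mem_iota ltn_mod => /(_ isT)/allP/(_ (b %% 4)%N).
by rewrite mem_iota ltn_mod /chi4 !modn_mod => /(_ isT)/eqP.
Qed.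

Lemma chi8M a b : chi8 (a * b) = chi8 a * chi8 b.
Proof.
rewrite /chi8 -modnMm.
have : all (fun i => all (fun j => chi8 (i * j) == chi8 i * chi8 j) (iota 0 8)) (iota 0 8) by [].
move=> /allP/(_ (a %% 8)%N); rewrite mem_iota ltn_mod => /(_ isT)/allP/(_ (b %% 8)%N).
by rewrite mem_iota ltn_mod /chi8 !modn_mod => /(_ isT)/eqP.
Qed.

Section Legendre.
Variable p : nat.
Hypotheses (p_pr : prime p) (p_odd : odd p).
Let h := p./2.
Let Ep : p = h.*2.+1.
Proof. by rewrite /h -{1}[p]odd_double_half p_odd. Qed.
Let h_gt0 : (0 < h)%N.
Proof. by have := prime_gt1 p_pr; rewrite Ep; case: h. Qed.

Lemma legendre_Fp a : (legendre p a)%:~R = a%:R ^+ h :> 'F_p.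
Proof.
rewrite /legendre; case: ifP => [pa|/negbT pa].
  have -> : a%:R = 0 :> 'F_p by apply/eqP; rewrite Fp_natr_eq0.
  by rewrite expr0n eqn0Ngt h_gt0.
by rewrite gauss_lemma // rmorphXn rmorphN1.
Qed.

Lemma legendre_nunit a : (p %| a)%N -> legendre p a = 0.
Proof. by rewrite /legendre => ->. Qed.

Lemma legendre_unit a : ~~ (p %| a)%N -> legendre p a = 1 \/ legendre p a = -1.
Proof.
rewrite /legendre => /negPf ->; rewrite -signr_odd.
by case: odd; [right|left].
Qed.

Lemma legendre_cases a : [\/ legendre p a = 0, legendre p a = 1 | legendre p a = -1].
Proof.
case: (boolP (p %| a)%N) => [/legendre_nunit|/legendre_unit[]] ->.
- by constructor 1.
- by constructor 2.
- by constructor 3.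
Qed.

Lemma sign_Fp_inj (x y : int) : [\/ x = 0, x = 1 | x = -1] -> [\/ y = 0, y = 1 | y = -1] ->
  x%:~R = y%:~R :> 'F_p -> x = y.
Proof.
have n1 : (1 : 'F_p) != 0 by apply: oner_neq0.
have n2 : (1 : 'F_p) + 1 != 0.
  rewrite -[1 + 1]/(2%:R) Fp_natr_eq0 //; apply/negP => /dvdn_leq; lia.
case=> -> [] ->; rewrite ?mulrN1z ?mulr1z ?mulr0z // => /eqP; rewrite ?oppr_eq0 ?(negPf n1) //.
- by rewrite eq_sym oppr_eq0 (negPf n1).
- by rewrite -subr_eq0 opprK (negPf n2).
- by rewrite eq_sym -subr_eq0 opprK (negPf n2).
Qed.

Lemma legendreM a b : legendre p (a * b) = legendre p a * legendre p b.
Proof.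
apply: sign_Fp_inj; first exact: legendre_cases.
  by case: (legendre_cases a) (legendre_cases b) => -> [] ->;
    (constructor 1; done) || (constructor 2; done) || (constructor 3; done).
by rewrite rmorphM /= !legendre_Fp natrM exprMn.
Qed.

Lemma legendre_mod a : legendre p (a %% p) = legendre p a.
Proof.
apply: sign_Fp_inj; try exact: legendre_cases.
by rewrite !legendre_Fp Fp_natr_mod.
Qed.

Lemma legendre_eqmod a b : a = b %[mod p] -> legendre p a = legendre p b.
Proof. by move=> E; rewrite -(legendre_mod a) E legendre_mod. Qed.

Lemma legendre1 : legendre p 1 = 1.
Proof.
apply: sign_Fp_inj; [exact: legendre_cases | by constructor 2 |].
by rewrite legendre_Fp expr1n.
Qed.

(** The squares of 1, ..., [h] are [h] distinct roots of [X^h - 1]; a further root would exceed the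
    degree. *)
Lemma legendre_square a : legendre p a = 1 -> exists x, (x * x = a %[mod p])%N.
Proof.
move=> La; have Ha : (a%:R : 'F_p) ^+ h = 1 by rewrite -legendre_Fp La.
pose s := [seq (k%:R : 'F_p) ^+ 2 | k <- index_iota 1 h.+1].
have s_root k : (0 < k <= h)%N -> ((k%:R : 'F_p) ^+ 2) ^+ h = 1.
  move=> /andP[k0 kh]; rewrite exprAC -legendre_Fp.
  have [|->|->] := @legendre_unit k; rewrite ?mulr1z ?mulrN1z ?sqrrN ?expr1n //.
  by apply/negP => /dvdn_leq; lia.
have s_uniq : uniq s.
  rewrite map_inj_in_uniq ?iota_uniq // => k l; rewrite !mem_index_iota !ltnS.
  move=> /andP[k0 kh] /andP[l0 lh] /eqP; rewrite eqf_sqr => /orP[/eqP|].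
    by apply: Fp_natr_inj => //; lia.
  rewrite -subr_eq0 opprK -natrD Fp_natr_eq0 // => /dvdn_leq; lia.
have [/mapP[k _ E]|as_] := boolP ((a%:R : 'F_p) \in s).
  exists k; apply: (Fp_natr_inj p_pr p_odd); rewrite ?ltn_mod ?prime_gt0 //.
  by rewrite !Fp_natr_mod // natrM E expr2.
pose P : {poly 'F_p} := 'X^h - 1.
have P0 : P != 0 by rewrite -size_poly_eq0 size_XnsubC.
have : all (root P) (a%:R :: s).
  rewrite /= rootE !hornerE Ha subrr eqxx /=.
  apply/allP => y /mapP[k]; rewrite mem_index_iota ltnS => /s_root Hk -> {y}.
  by rewrite rootE !hornerE Hk subrr.
move=> /(max_poly_roots P0)/(_ _); rewrite /= as_ s_uniq => /(_ isT).
by rewrite size_XnsubC // size_map size_iota subSS subn0 ltnn.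
Qed.

Lemma legendre_predn : legendre p p.-1 = chi4 p.
Proof.
have -> : chi4 p = (-1) ^+ h.
  rewrite -signr_odd /chi4 {1}Ep; have [k] : exists k, h = (k.*2 + odd h)%N.
    by exists h./2; rewrite addnC odd_double_half.
  case: (odd h) => ->.
    by rewrite (_ : _ %% 4 = 3)%N //; lia.
  by rewrite (_ : _ %% 4 = 1)%N //; lia.
apply: sign_Fp_inj; first exact: legendre_cases.
  by rewrite -signr_odd; case: odd; [constructor 3 | constructor 2].
rewrite legendre_Fp rmorphXn rmorphN1; congr (_ ^+ _).
by rewrite -subn1 natrB ?prime_gt0 // pchar_Fp_0 // sub0r.
Qed.

Lemma legendre2 : legendre p 2 = chi8 p.
Proof.
rewrite /legendre; case: ifP => [/dvdn_leq|_]; first by lia.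
rewrite -signr_odd gauss_count2 // -/h /chi8 {1}Ep.
have [k [r [r4 Eh]]] : exists k r, (r < 4)%N /\ (h = k * 4 + r)%N.
  by exists (h %/ 4)%N, (h %% 4)%N; rewrite ltn_mod -divn_eq.
rewrite Eh; case: r r4 {Eh} => [|[|[|[|]]]] // _.
- rewrite (_ : _ %% 8 = 1)%N; last by lia.
  by rewrite (_ : _./2 = (k * (k * 4 + 1)).*2)%N ?odd_double //; lia.
- rewrite (_ : _ %% 8 = 3)%N; last by lia.
  by rewrite (_ : _./2 = (4 * k * k + 3 * k).*2.+1)%N /= ?odd_double //; lia.
- rewrite (_ : _ %% 8 = 5)%N; last by lia.
  by rewrite (_ : _./2 = (4 * k * k + 5 * k + 1).*2.+1)%N /= ?odd_double //; lia.
- rewrite (_ : _ %% 8 = 7)%N; last by lia.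
  by rewrite (_ : _./2 = (4 * k * k + 7 * k + 3).*2)%N ?odd_double //; lia.
Qed.
End Legendre.

Lemma legendre_reciprocity p q : prime p -> prime q -> odd q -> (p %% 4 = 1)%N ->
  legendre p q = legendre q p.
Proof.
move=> pP qP qo p1; have po : odd p by lia.
case: (eqVneq p q) => [-> //|pq].
rewrite /legendre !dvdn_prime2 // (negPf pq) eq_sym (negPf pq) -signr_odd -[in RHS]signr_odd.
congr ((-1) ^+ nat_of_bool _); apply/eqP; rewrite eq_sym -negb_add -addbN.
have := gauss_count_reciprocity pP qP po qo pq; rewrite oddM.
have -> : odd p./2 = false by lia.
by do 2!case: (odd _).
Qed.

(** * The three-square theorem *)

Local Notation R := Rdefinitions.R.

Lemma ln_mulnat a b : (0 < a)%N -> (0 < b)%N ->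
  ln ((a * b)%:R : R) = ln (a%:R : R) + ln (b%:R : R).
Proof.
move=> a0 b0; rewrite natrM; apply: ln_mult; by apply/RltP; rewrite ltr0n.
Qed.

Lemma ln_le_sub1 (x : R) : 0 < x -> ln x <= x - 1.
Proof.
move=> x0; have := exp_ineq1_le (ln x); rewrite exp_ln; last exact/RltP.
by move=> /RleP; rewrite RplusE R1E; lra.
Qed.

Lemma ln_step n : (0 < n)%N ->
  n.+1%:R^-1 <= ln (n.+1%:R : R) - ln (n%:R : R) /\ ln (n.+1%:R : R) - ln (n%:R : R) <= n%:R^-1.
Proof.
move=> n0; have p0 : 0 < n%:R :> R by rewrite ltr0n.
have p1 : 0 < n.+1%:R :> R by rewrite ltr0n.
have lnq (x y : R) : 0 < x -> 0 < y -> ln (x / y) = ln x - ln y.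
  move=> x0 y0; rewrite -[ln x](_ : ln (x / y * y) = _); last by rewrite divfK // lt0r_neq0.
  rewrite -[X in X = _](addrK (ln y)); congr (_ - _); symmetry.
  by apply: ln_mult; apply/RltP => //; rewrite divr_gt0.
have H1 : ln (n.+1%:R / n%:R : R) <= n%:R^-1.
  apply: le_trans (ln_le_sub1 _) _; first by rewrite divr_gt0.
  by rewrite -natr1 mulrDl mulfV ?lt0r_neq0 // mul1r addrAC subrr add0r.
have H2 : ln (n%:R / n.+1%:R : R) <= - n.+1%:R^-1.
  apply: le_trans (ln_le_sub1 _) _; first by rewrite divr_gt0.
  rewrite -[X in _ - X](mulfV (lt0r_neq0 p1)) -mulrBl -[n.+1%:R in X in X / _]natr1.
  by rewrite opprD addrA subrr add0r mulN1r.
rewrite lnq // in H1; rewrite lnq // in H2; split=> //.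
by move: H2; rewrite lerNr opprB.
Qed.

Lemma real_char_lift m d (chi : nat -> int) : (d %| m)%N ->
  (forall a b, chi (a * b)%N = chi a * chi b) ->
  (forall a b, a = b %[mod d] -> chi a = chi b) ->
  (forall a, coprime a d -> chi a = 1 \/ chi a = -1) ->
  real_char m (fun a => principal R m a * (chi a)%:~R).
Proof.
move=> dm chiM chi_mod chi_unit; have [PM PD _ _] := principalP R m.
split=> [a b|a|a cp|a].
- by rewrite PM chiM rmorphM mulrACA.
- rewrite PD; congr (_ * _%:~R); apply: chi_mod.
  by case/dvdnP: dm => k ->; rewrite addnC modnMDl.
- rewrite /principal cp mul1r; case: (chi_unit a) => [|->|->].
  + by apply: coprime_dvdr cp.
  + by left; rewrite mulr1z.
  + by right; rewrite mulrN1z.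
- by rewrite /principal => /negPf->; rewrite mul0r.
Qed.

Lemma exists_prime_symbols m c r (X : nat -> nat -> int) (d : nat -> nat) :
  (0 < m)%N -> coprime c m ->
  (forall i, (i < r)%N -> (d i %| m)%N /\
    [/\ forall a b, X i (a * b)%N = X i a * X i b,
        forall a b, a = b %[mod d i] -> X i a = X i b &
        forall a, coprime a (d i) -> X i a = 1 \/ X i a = -1]) ->
  exists p, [/\ prime p, coprime p m & forall i, (i < r)%N -> X i p = X i c].
Proof.
move=> m0 cm HX.
have [|p [pp cp Hp]] := @exists_prime_characters _ _ ln_mulnat ln_step m c m0 cm
    (fun i a => principal R m a * (X i a)%:~R) r.
  by move=> i /HX[dm [H1 H2 H3]]; apply: real_char_lift dm H1 H2 H3.
exists p; split=> // i /Hp; rewrite /principal cp cm !mul1r => /eqP.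
by rewrite eqr_int => /eqP.
Qed.

Definition sqfree n := forall q, prime q -> ~~ (q * q %| n)%N.

Lemma sqfree_prod n : (0 < n)%N -> sqfree n -> \prod_(q <- primes n) q = n.
Proof.
move=> n0 sq; rewrite [RHS]prod_prime_decomp // prime_decompE big_map /=.
rewrite !big_seq; apply: eq_bigr => q; rewrite mem_primes => /and3P[qp _ qn].
suff -> : logn q n = 1%N by rewrite expn1.
have l1 : (0 < logn q n)%N by rewrite logn_gt0 mem_primes qp n0 qn.
apply/eqP; rewrite eqn_leq l1 andbT leqNgt.
apply/negP => l2; case/negP: (sq q qp); by rewrite -[(q * q)%N]/(q ^ 2)%N pfactor_dvdn.
Qed.

Lemma sqrt_mod_prod A ps : uniq ps -> all prime ps ->
  (forall l, l \in ps -> exists x, (l %| A + x * x)%N) ->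
  exists s, (\prod_(l <- ps) l %| A + s * s)%N.
Proof.
elim: ps => [|l ps IH] /=; first by exists 0%N; rewrite big_nil dvd1n.
move=> /andP[lps ups] /andP[lp pps] H.
have [|s Hs] := IH ups pps; first by move=> q qps; apply: H; rewrite inE qps orbT.
have [x Hx] := H l (mem_head _ _).
have cop : coprime l (\prod_(l <- ps) l).
  rewrite big_seq; apply: (big_ind (fun x => coprime l x)) => [|x1 x2 H1 H2|q qps]; rewrite ?coprimen1 // ?coprimeMr ?H1 //.
  rewrite prime_coprime // dvdn_prime2 //.
    by apply: contraNneq lps => ->.
  exact: (allP pps).
exists (chinese l (\prod_(l <- ps) l) x s); rewrite big_cons Gauss_dvd //.
have E d y z : y = z %[mod d] -> (d %| A + z * z)%N -> (d %| A + y * y)%N.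
  by move=> Eyz; rewrite /dvdn -[in X in _ -> X]modnDmr -[in X in _ -> X]modnMm Eyz modnMm modnDmr.
by apply/andP; split; [apply: (E _ _ x) | apply: (E _ _ s)] => //; [exact: chinese_modl | exact: chinese_modr].
Qed.

Lemma chi4_eqmod a b : a = b %[mod 4] -> chi4 a = chi4 b.
Proof. by rewrite /chi4 => ->. Qed.

Lemma chi8_eqmod a b : a = b %[mod 8] -> chi8 a = chi8 b.
Proof. by rewrite /chi8 => ->. Qed.

Lemma chi4_unit a : odd a -> chi4 a = 1 \/ chi4 a = -1.
Proof.
move=> a_odd; have : (a %% 4 = 1 \/ a %% 4 = 3)%N by lia.
by rewrite /chi4; case=> ->; [left|right].
Qed.

Lemma chi8_unit a : odd a -> chi8 a = 1 \/ chi8 a = -1.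
Proof.
move=> a_odd; have : (a %% 8 = 1 \/ a %% 8 = 3 \/ a %% 8 = 5 \/ a %% 8 = 7)%N by lia.
by rewrite /chi8; case=> [->|[->|[->|->]]]; [left|right|right|left].
Qed.

Lemma exists_prime_mod_squares n v w : (0 < n)%N -> odd n -> coprime v n ->
  (w %% 8 = 1 \/ w %% 8 = 5)%N ->
  exists p, [/\ prime p, (p %% 8 = w %% 8)%N, coprime p n &
    forall l, prime l -> (l %| n)%N -> legendre l p = legendre l v].
Proof.
move=> n0 n_odd vn w15.
have cop8n : coprime 8 n by rewrite (@coprimeXl 3 2) // coprime2n.
(* [c] only prescribes character values: [chi4] and [chi8] recover [p] modulo 8, while modulo each
   [l] only the symbol of [v] is matched. *)
pose c := chinese 8 n w v.
have cw : c = w %[mod 8] by apply: chinese_modl.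
have cv : c = v %[mod n] by apply: chinese_modr.
have c_cop : coprime c (8 * n).
  rewrite coprimeMr; apply/andP; split; last by rewrite -coprime_modl cv coprime_modl.
  by rewrite -coprime_modl cw; case: w15 => ->.
pose ps := primes n.
pose X i := if i is i'.+2 then legendre (nth 0%N ps i') else if i is 1 then chi8 else chi4.
pose d i := if i is i'.+2 then nth 0%N ps i' else if i is 1 then 8 else 4.
have [|||p [pp pc Hp]] := @exists_prime_symbols (8 * n) c (size ps).+2 X d.
- by rewrite muln_gt0.
- exact: c_cop.
- case=> [|[|i]] /= ir.
  + split; first by rewrite dvdn_mulr.
    split=> [|a b|a]; [exact: chi4M | exact: chi4_eqmod |].
    by rewrite (@coprime_pexpr 2 a 2) // coprimen2 => /chi4_unit.
  + split; first by rewrite dvdn_mulr.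
    split=> [|a b|a]; [exact: chi8M | exact: chi8_eqmod |].
    by rewrite (@coprime_pexpr 3 a 2) // coprimen2 => /chi8_unit.
  + have : nth 0%N ps i \in ps by rewrite mem_nth.
    rewrite mem_primes n0 /=; set l := nth _ _ _ => /andP[lp ln].
    have lo : odd l by apply: dvdn_odd ln n_odd.
    split; first by rewrite dvdn_mull.
    split=> [a b|a b|a]; [exact: legendreM | exact: legendre_eqmod |].
    by rewrite coprime_sym prime_coprime // => /legendre_unit.
exists p; rewrite coprimeMr in pc; case/andP: pc => p8 pn.
have p_odd : odd p by rewrite -coprimen2 (coprime_dvdr _ p8).
split=> //.
  have := Hp 0%N isT; have := Hp 1%N isT.
  rewrite /X (chi4_eqmod (a := c) (b := w)) ?(chi8_eqmod cw); last by lia.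
  have : (p %% 8 = 1 \/ p %% 8 = 3 \/ p %% 8 = 5 \/ p %% 8 = 7)%N by lia.
  rewrite /chi8 /chi4; have E x : (x %% 4 = (x %% 8) %% 4)%N by lia.
  rewrite (E p) (E w).
  by case: w15 => ->; case=> [->|[->|[->|->]]].
move=> l lp ln; have l_in : l \in ps by rewrite mem_primes lp n0.
have := Hp (index l ps).+2; rewrite !ltnS index_mem /= nth_index // => /(_ l_in) ->.
have lo : odd l by apply: dvdn_odd ln n_odd.
by apply: legendre_eqmod => //; rewrite -(modn_dvdm c ln) cv modn_dvdm.
Qed.

(* Modulo each prime [l | n], the prime [p] is a square times [v = - 1 / a]. *)
Section Residues.
Variables (n a v p : nat).
Hypotheses (n_gt0 : (0 < n)%N) (n_odd : odd n) (n_sq : sqfree n).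
Hypotheses (av : (a * v = n.-1)%N) (p_pr : prime p) (p4 : (p %% 4 = 1)%N).
Hypothesis pv : forall l, prime l -> (l %| n)%N -> legendre l p = legendre l v.

Let prime_dvdP l : l \in primes n -> [/\ prime l, (l %| n)%N & odd l].
Proof.
by rewrite mem_primes n_gt0 /= => /andP[lp ln]; split=> //; apply: dvdn_odd ln n_odd.
Qed.

Lemma residue_legendre l : l \in primes n -> legendre l a * legendre l p = chi4 l.
Proof.
case/prime_dvdP => lp ln lo; rewrite pv // -legendreM // av -legendre_predn //.
apply: legendre_eqmod => //; have l0 := prime_gt0 lp.
case/dvdnP: ln n_gt0 => k ->; rewrite muln_gt0 => /andP[k0 _].
have -> : ((k * l).-1 = k.-1 * l + l.-1)%N by case: k k0 => // k _; lia.
by rewrite modnMDl.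
Qed.

Lemma sqrt_opp_mod : exists s, (n %| a * p + s * s)%N.
Proof.
rewrite -{1}(sqfree_prod n_gt0 n_sq).
apply: sqrt_mod_prod; [exact: primes_uniq | exact: all_prime_primes |].
move=> l l_in; have [lp ln lo] := prime_dvdP l_in.
have [|x Hx] := @legendre_square l lp lo (a * p * l.-1).
  rewrite !legendreM // (residue_legendre l_in) legendre_predn //.
  by case: (chi4_unit lo) => ->.
exists x; rewrite /dvdn -modnDmr Hx modnDmr -mulnS prednK ?prime_gt0 //.
by rewrite modnMl.
Qed.

(** The product of [residue_legendre] over the primes [l] of [n]; reciprocity, without sign since
    [p] is 1 mod 4, turns the symbols of [p] into that of [n] modulo [p]. *)
Lemma legendre_modulus :
  \prod_(l <- primes n) legendre l a * legendre p n = chi4 n.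
Proof.
have p_odd : odd p by lia.
rewrite -{2 3}(sqfree_prod n_gt0 n_sq).
rewrite (big_morph chi4 chi4M (erefl _)).
rewrite (big_morph (legendre p) (legendreM p_pr p_odd) (legendre1 p_pr p_odd)).
rewrite -big_split /= !big_seq; apply: eq_bigr => l l_in.
have [lp ln lo] := prime_dvdP l_in.
by rewrite (legendre_reciprocity p_pr lp lo p4) residue_legendre.
Qed.
End Residues.

Lemma sqrt_opp p n : prime p -> (p %% 4 = 1)%N -> legendre p n = 1 ->
  exists B, (p %| n + B * B)%N.
Proof.
move=> pp p4 Ln; have po : odd p by lia.
have [|x Hx] := @legendre_square p pp po (n * p.-1).
  by rewrite legendreM // Ln legendre_predn // /chi4 p4.
exists x; rewrite /dvdn -modnDmr Hx modnDmr -mulnS prednK ?prime_gt0 //.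
by rewrite modnMl.
Qed.

(** By [legendre_modulus] the symbol of [n] modulo [p] is [chi4 n = 1] when [n] is 1 mod 4 and
    [A = p]. For 3 mod 8, [chi4 n = -1] is offset by [chi8 n = -1], whence [A = 2p]. For [n = 2k],
    the factor 2 brings in [chi8 p]. *)
Lemma exists_residues n : (0 < n)%N -> sqfree n -> (n %% 8 \in [:: 1; 2; 3; 5; 6])%N ->
  exists A s B, [/\ (0 < A)%N, coprime A n, (n %| A + s * s)%N & (A %| n + B * B)%N].
Proof.
move=> n0 sq; have cop_pred k : (0 < k)%N -> coprime k.-1 k by case: k => // k _; rewrite coprimenS.
have lp1 k : odd k -> \prod_(l <- primes k) legendre l 1 = 1.
  case: k => // k k_odd; rewrite big_seq big1 // => l; rewrite mem_primes => /and3P[lp _ lk].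
  by apply: legendre1 => //; apply: dvdn_odd lk k_odd.
have [n4|] := eqVneq (n %% 4)%N 1%N.
  move=> _; have n_odd : odd n by lia.
  have [|p [pp p8 pn Hp]] := @exists_prime_mod_squares n n.-1 1 n0 n_odd (cop_pred n n0); first by left.
  have p4 : (p %% 4 = 1)%N by lia.
  have [s Hs] := sqrt_opp_mod n0 n_odd sq (mul1n n.-1) pp p4 Hp.
  have := legendre_modulus n0 n_odd sq (mul1n n.-1) pp p4 Hp.
  rewrite lp1 // mul1r /chi4 n4 => /(sqrt_opp pp p4)[B HB].
  by exists p, s, B; rewrite mul1n in Hs; rewrite prime_gt0.
have [n8 _|] := eqVneq (n %% 8)%N 3%N.
  move=> _; have n_odd : odd n by lia.
  have Ev : (2 * n.-1./2 = n.-1)%N by lia.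
  have [||p [pp p8 pn Hp]] := @exists_prime_mod_squares n n.-1./2 1 n0 n_odd.
  - by apply: coprime_dvdl (cop_pred n n0); rewrite -[X in (_ %| X)%N]Ev dvdn_mull.
  - by left.
  have p4 : (p %% 4 = 1)%N by lia.
  have [s Hs] := sqrt_opp_mod n0 n_odd sq Ev pp p4 Hp.
  have := legendre_modulus n0 n_odd sq Ev pp p4 Hp.
  have -> : \prod_(l <- primes n) legendre l 2 = chi8 n.
    rewrite -[in RHS](sqfree_prod n0 sq) (big_morph chi8 chi8M (erefl _)) !big_seq.
    apply: eq_bigr => l; rewrite mem_primes => /and3P[lp _ ln].
    by apply: legendre2 => //; apply: dvdn_odd ln n_odd.
  rewrite /chi8 /chi4 n8 (_ : n %% 4 = 3)%N; last by lia.
  rewrite /= mulN1r => /oppr_inj/(sqrt_opp pp p4)[B HB].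
  have p_odd : odd p by lia.
  have cop2p : coprime 2 p by rewrite coprime2n.
  have p_gt0 := prime_gt0 pp.
  (* [n] is odd, so divisibility by 2 asks for an odd root; adding the odd [p] changes the
     parity. *)
  pose B' := if odd B then B else (B + p)%N.
  exists (2 * p)%N, s, B'; split=> //.
  - by rewrite muln_gt0.
  - by rewrite coprimeMl coprime2n n_odd.
  rewrite Gauss_dvd // dvdn2 /B'; case: ifP => Bo; rewrite oddD oddM ?oddD n_odd ?p_odd ?Bo //=.
  rewrite (_ : n + (B + p) * (B + p) = n + B * B + p * (2 * B + p))%N; last by lia.
  by rewrite dvdn_addr // dvdn_mulr.
move=> n3 n1 Hn; have n_even : (n %% 4 = 2)%N.
  by move: Hn; rewrite !inE => /or4P[/eqP|/eqP|/eqP|/orP[/eqP|/eqP]]; lia.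
pose k := n./2; have En : n = (2 * k)%N by rewrite /k; lia.
have k_odd : odd k by lia.
have k0 : (0 < k)%N by lia.
have ksq : sqfree k by move=> q /sq; apply: contra => qk; rewrite En dvdn_mull.
(* Chosen so that [chi8 p = chi4 k]: the symbols of 2 and of [k] modulo [p] agree and their product
   is 1. *)
pose w := if (k %% 4 == 1)%N then 1%N else 5%N.
have [|p [pp p8 pk Hp]] := @exists_prime_mod_squares k k.-1 w k0 k_odd (cop_pred k k0).
  by rewrite /w; case: ifP; [left|right].
have p4 : (p %% 4 = 1)%N by move: p8; rewrite /w; case: ifP => _; lia.
have p_odd : odd p by lia.
have [s Hs] := sqrt_opp_mod k0 k_odd ksq (mul1n k.-1) pp p4 Hp.
have := legendre_modulus k0 k_odd ksq (mul1n k.-1) pp p4 Hp.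
rewrite lp1 // mul1r => Lk.
have : legendre p n = 1.
  rewrite En legendreM // Lk legendre2 // /chi8 p8 /chi4 /w; case: eqP => [->|k4] //.
  by rewrite (_ : k %% 4 = 3)%N //; lia.
move/(sqrt_opp pp p4) => [B HB].
pose s' := if odd s then s else (s + k)%N.
exists p, s', B; split=> //; first exact: prime_gt0.
  by rewrite En coprimeMr coprimen2 p_odd.
rewrite [X in (X %| _)%N]En Gauss_dvd ?coprime2n // dvdn2 oddD oddM p_odd.
rewrite mul1n in Hs; rewrite /s'; case: ifP => so; rewrite ?oddD ?so ?k_odd ?Hs //=.
rewrite (_ : p + (s + k) * (s + k) = p + s * s + k * (2 * s + k))%N; last by lia.
by rewrite dvdn_addr // dvdn_mulr.
Qed.

Unset Implicit Arguments.
Open Scope Z_scope.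

Lemma sum3sq_sqfree (n : nat) : (0 < n)%N -> sqfree n ->
  (n %% 8 \in [:: 1; 2; 3; 5; 6])%N -> sum3sq (Z.of_nat n).
Proof.
move=> n0 sq n8; have [A [s [B [A0 cop /dvdnP[k Ek] /dvdnP[C EC]]]]] := exists_residues n0 sq n8.
apply: (sum3sq_of_residues _ (Z.of_nat A) (Z.of_nat s) (Z.of_nat B)); try lia.
- case: (egcdnP n A0) => u t E _; move: E; rewrite (eqP cop) => E.
  by exists (Z.of_nat u), (Z.of_nat t); lia.
- by exists (Z.of_nat k); lia.
- by exists (Z.of_nat C); lia.
Qed.

(** Square factors are divided out. Since 4 does not divide [n], such a [q] is odd, so [q^2] is 1
    mod 8 and the residue class survives. *)
Lemma sum3sq_nat (n : nat) : (0 < n)%N -> (n %% 8 \in [:: 1; 2; 3; 5; 6])%N -> sum3sq (Z.of_nat n).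
Proof.
elim/ltn_ind: n => n IH n0 n8.
case: (boolP [exists q : 'I_n.+1, prime q && (q * q %| n)%N]) => [/existsP[q /andP[qp qn]]|Hn]; last first.
  apply: sum3sq_sqfree => // q qp; apply: contraNN Hn => qn; apply/existsP.
  have qn' : (q < n.+1)%N.
    by rewrite ltnS (leq_trans _ (dvdn_leq n0 qn)) // leq_pmulr // prime_gt0.
  by exists (Ordinal qn'); rewrite /= qp.
case/dvdnP: qn => k En; have q1 := prime_gt1 qp.
have q_odd : odd q.
  apply/negPn/negP => qe; move: n8; have [r Er] : exists r, nat_of_ord q = (2 * r)%N by exists q./2; lia.
  by rewrite En Er !inE; lia.
have k8 : (k %% 8 = n %% 8)%N.
  have [r Er] : exists r, nat_of_ord q = (2 * r + 1)%N by exists q./2; lia.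
  have [t Et] : exists t, (r * r + r = 2 * t)%N.
    by exists (r * r.+1)./2; case: (boolP (odd r)); lia.
  by rewrite En Er (_ : k * _ = k + (t * k) * 8)%N ?modnMDr; lia.
have k0 : (0 < k)%N by case: k En {k8} => // E; rewrite E in n0.
have kn : (k < n)%N by rewrite En ltn_Pmulr //; nia.
have [x [y [z E]]] := IH k kn k0 (eq_ind_r (fun i => i \in _) n8 k8).
exists (Z.of_nat q * x), (Z.of_nat q * y), (Z.of_nat q * z).
have -> : Z.of_nat n = Z.of_nat k * (Z.of_nat q * Z.of_nat q) by lia.
rewrite E; lia.
Qed.

Lemma sum3sq_residue k : 0 < k ->
  (exists j, k = 8 * j + 1 \/ k = 8 * j + 2 \/ k = 8 * j + 3 \/ k = 8 * j + 5 \/ k = 8 * j + 6) ->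
  sum3sq k.
Proof.
move=> k0 [j Hj]; rewrite -(Z2Nat.id k); last by lia.
by apply: sum3sq_nat; rewrite ?inE; lia.
Qed.

Theorem theorem2 : forall n : Z, 0 <= n ->
  (exists x y z : Z, n = x^2 + 3 * y^2 + tri z) /\
  (exists x y z : Z, n = x^2 + 3 * tri y + tri z) /\
  (exists x y z : Z, n = x^2 + 6 * tri y + tri z) /\
  (exists x y z : Z, n = 3 * x^2 + 2 * tri y + tri z) /\
  (exists x y z : Z, n = 4 * x^2 + 2 * tri y + tri z).
Proof.
intros n Hn; repeat split.
- destruct (form1 n) as (x & y & z & E).
  { apply sum3sq_residue; [lia | exists (3 * n); lia]. }
  exists x, y, z; rewrite !Z.pow_2_r; exact E.
- destruct (form2 n) as (x & y & z & E).
  { apply sum3sq_residue; [lia |].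
    (* [12 n + 6] is 6 mod 8 for even [n] and 2 mod 8 for odd [n]. *)
    destruct (Z.Even_or_Odd n) as [[i ->]|[i ->]]; [exists (3 * i) | exists (3 * i + 2)]; lia. }
  exists x, y, z; rewrite !Z.pow_2_r; exact E.
- destruct (form3 n) as (x & y & z & E).
  { apply sum3sq_residue; [lia | exists (3 * n + 2); lia]. }
  exists x, y, z; rewrite !Z.pow_2_r; exact E.
- destruct (form4 n) as (x & y & z & E).
  { apply sum3sq_residue; [lia | exists (3 * n + 1); lia]. }
  exists x, y, z; rewrite !Z.pow_2_r; exact E.
- destruct (form5 n) as (x & y & z & E).
  { apply sum3sq_residue; [lia | exists n; lia]. }
  exists x, y, z; rewrite !Z.pow_2_r; exact E.
Qed.
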